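(* Let $X_N$ be the $N\times N$ GOE random matrix and let $m_n$ be the $n$-th moment of the semi-circle law $\frac{\sqrt{4-x^2}}{2\pi}\,dx$ on $[-2,2]$. Then for every integer $n\ge1$ the infinitesimal moment $$m'_n=\lim_{N\to\infty} N\big(\mathrm{E}(\mathrm{tr}(X_N^n))-m_n\big)$$ exists, and $m'_n=|NC_2^\delta(n,-n)|$ for $n$ even, while $m'_n=0$ for $n$ odd.
   Context: GOE: $X_N=\frac{1}{\sqrt{2N}}(G+G^{t})$ where $G=(g_{ij})_{i,j=1}^N$ has independent identically distributed real $\mathcal{N}(0,1)$ entries and $G^t$ is the transpose. $\mathrm{tr}$ is the normalized trace $\frac1N\mathrm{Tr}$, $\mathrm{E}$ is expectation. Definition of $NC_2^\delta(n,-n)$. Let $[\pm n]=\{1,\dots,n,-1,\dots,-n\}$ and let $S_{\pm n}$ be the group of permutations of $[\pm n]$ (products composed right to left). Let $\gamma=(1,2,\dots,n)$, regarded as an element of $S_{\pm n}$ acting trivially on $\{-1,\dots,-n\}$, and let $\delta\in S_{\pm n}$ be $\delta(k)=-k$. So $\gamma\delta\gamma^{-1}\delta$ has two cycles, one on $\{1,\dots,n\}$ and one on $\{-1,\dots,-n\}$. For a permutation $\pi$, $\#(\pi)$ is its number of cycles. A pairing of $[\pm n]$ (partition into blocks of size 2) is identified with the corresponding fixed-point-free involution. A pairing $\rho$ of $[\pm n]$ is a non-crossing annular pairing if it has at least one pair $(r,s)$ with $r$ and $s$ of opposite signs and $\#(\gamma\delta\gamma^{-1}\delta\,\rho)=n$.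 For $n$ even, $NC_2^\delta(n,-n)$ is the set of non-crossing annular pairings $\rho$ of $[\pm n]$ such that: (i) $\rho$ commutes with $\delta$; (ii) $(r,-r)$ is never a pair of $\rho$; (iii) if $(r,s)$ is a pair of $\rho$ then so is $(-r,-s)$. For $n$ odd it is empty by convention. *)

(* Defs.v *)
From HB Require Import structures.
From mathcomp Require Import all_boot all_order all_algebra fingroup perm.
From mathcomp Require Import all_classical all_reals all_analysis.

Set Implicit Arguments.
Unset Strict Implicit.
Unset Printing Implicit Defensive.

Import Order.TTheory GRing.Theory Num.Theory.
Import numFieldNormedType.Exports.

Local Open Scope classical_set_scope.
Local Open Scope ring_scope.

Definition mutually_independent (d : measure_display) (T : measurableType d)
    (R : realType) (P : probability T R) (I : finType)
    (X : I -> {RV P >-> R}) : Prop :=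
  forall (J : {set I}) (A : I -> set R), (forall i, measurable (A i)) ->
    P (\big[setI/setT]_(i in J) (X i @^-1` A i))
    = (\prod_(i in J) P (X i @^-1` A i))%E.

Definition standard_normal (d : measure_display) (T : measurableType d)
    (R : realType) (P : probability T R) (X : {RV P >-> R}) : Prop :=
  forall A : set R, measurable A -> distribution P X A = normal_prob 0 1 A.

Definition iid_standard_normal (d : measure_display) (T : measurableType d)
    (R : realType) (P : probability T R) (N : nat)
    (g : 'I_N * 'I_N -> {RV P >-> R}) : Prop :=
  mutually_independent g /\ (forall ij, standard_normal (g ij)).

Definition goe (d : measure_display) (T : measurableType d)
    (R : realType) (P : probability T R) (N : nat)
    (g : 'I_N * 'I_N -> {RV P >-> R}) (w : T) : 'M[R]_N :=
  let G := \matrix_(i < N, j < N) g (i, j) w in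
  (Num.sqrt (2 * N)%:R)^-1 *: (G + G^T).

Definition ntr (R : realType) (N : nat) (A : 'M[R]_N) : R := N%:R^-1 * \tr A.

Definition semicircle_moment (R : realType) (n : nat) : R :=
  \int[lebesgue_measure]_(x in `[(- 2 : R), 2])
    (x ^+ n * (Num.sqrt (4 - x ^+ 2) / (2 * pi))).

(* [(false, k)] stands for the integer k + 1, and [(true, k)] for - (k + 1). *)
Definition pm (n : nat) : finType := (bool * 'I_n)%type.

Definition pm_opp (n : nat) (x : pm n) : pm n := (~~ x.1, x.2).

Lemma pm_opp_inj (n : nat) : injective (@pm_opp n).
Proof. by move=> [[] i] [[] j] //= [->]. Qed.

Definition delta_perm (n : nat) : {perm pm n} := perm (@pm_opp_inj n).

Definition gamma_fun (n : nat) (x : pm n) : pm n :=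
  if x.1 then x else (false, ordS x.2).

Lemma gamma_fun_inj (n : nat) : injective (@gamma_fun n).
Proof.
rewrite /gamma_fun => -[[] i] [[] j] //= [] h.
by congr pair; apply/ordS_inj/val_inj.
Qed.

Definition gamma_perm (n : nat) : {perm pm n} := perm (@gamma_fun_inj n).

(* The library composes permutations from left to right; [compr s t] is the
   permutation x |-> s (t x). *)
Definition compr (T : finType) (s t : {perm T}) : {perm T} := (t * s)%g.

Definition annulus_perm (n : nat) : {perm pm n} :=
  compr (gamma_perm n)
    (compr (delta_perm n) (compr (gamma_perm n)^-1%g (delta_perm n))).

Definition is_pairing (T : finType) (rho : {perm T}) : bool :=
  [forall x, (rho (rho x) == x) && (rho x != x)].

Definition nc_annular_pairing (n : nat) (rho : {perm pm n}) : bool :=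
  [&& is_pairing rho,
      [exists x, (rho x).1 != x.1]
    & #|porbits (compr (annulus_perm n) rho)| == n].

Definition NC2delta (n : nat) : {set {perm pm n}} :=
  if odd n then finset.set0 else
  [set rho : {perm pm n} |
    [&& nc_annular_pairing rho,
        compr rho (delta_perm n) == compr (delta_perm n) rho,
        [forall r, rho r != pm_opp r]
      & [forall r, forall s, (rho r == s) ==> (rho (pm_opp r) == pm_opp s)]]]%SET.

(* Main.v *)
(* Wick's formula writes E tr(X_N^n) as a sum over gluings of the edges of an
   n-gon, a gluing contributing N^(V - 1 - n/2), where V is its number of
   vertices. A gluing is a pairing rho of [+-n] commuting with delta, and V is half
   the number of cycles of gamma delta gamma^-1 delta rho, because that
   permutation is a product of two fixed-point-free involutions. Multiplying a
   permutation by a transposition changes its number of cycles by one; hence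
   V <= n/2 if rho has a through pair, and otherwise V <= n/2 + 1 with
   V = n/2 + 1 mod 2. So the gluings with V = n/2 are exactly NC_2^delta(n, -n),
   and only the count of those with V = n/2 + 1 remains. That count is the limit
   of E tr(X_N^n), which the Schwinger-Dyson equations (Gaussian integration by
   parts) determine by induction on the degree: products of traces factorise in
   the limit, and the limits satisfy the convolution recursion of the Catalan
   numbers, which is also satisfied by the semicircle moments. *)
Require Import Defs.
From HB Require Import structures.
From mathcomp Require Import all_boot all_order all_algebra fingroup perm.
From mathcomp Require Import ring lra zify.

Set Implicit Arguments.
Unset Strict Implicit.
Unset Printing Implicit Defensive.

Import Order.TTheory GRing.Theory Num.Theory.

(** * Cycles of products with involutions *)

Section PermCounting.
Local Open Scope nat_scope.

(** Numbers of cycles are compared through labellings: those invariant under a permutation number N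
    ^ (number of cycles), so equal counts of labellings give equal exponents. The same count is the
    sum over matrix indices in Wick's formula, so V receives its combinatorial and its matrix
    meaning together. Expectation is treated as an abstract functional on polynomial functions of
    the entries, linear and subject to Stein's identity. Differentiation is then formal, and measure
    theory enters only to show that i.i.d. standard normal variables give such a functional. The
    Schwinger-Dyson equation of one trace produces products of several, so limits are established
    for all finite products at once. Non-crossing pairings are never enumerated: the expected trace
    tends to m_n by these equations and to the number of gluings with V = n/2 + 1 by Wick's formula,
    and limits are unique. Given this equality of numbers, the terms of order N^0 cancel exactly for
    each N > 0 before the multiplication by N, so no rate of convergence is involved. *)

Lemma card_ffun_fiber (A B : finType) (r : A -> B) (N : nat) :
  #|[set f : {ffun A -> 'I_N} |
      [forall x, forall y, (r x == r y) ==> (f x == f y)]]|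
  = N ^ #|[set r x | x : A]|.
Proof.
pose U := {b : B | b \in [set r x | x : A]}.
have rU x : r x \in [set r x | x : A] by rewrite imset_f.
pose h (g : {ffun U -> 'I_N}) : {ffun A -> 'I_N} := [ffun x => g (exist _ (r x) (rU x))].
have exU (u : U) : exists x, r x == val u.
  by case: u => b /= /imsetP[x _ ->]; exists x.
have h_inj : injective h.
  move=> g1 g2 /ffunP e; apply/ffunP => u.
  have /eqP ux := xchooseP (exU u); move: (e (xchoose (exU u))); rewrite !ffunE.
  by have -> : exist _ (r (xchoose (exU u))) (rU (xchoose (exU u))) = u by apply: val_inj.
rewrite -[in RHS](card_ord N) -(card_sig [in [set r x | x : A]]) -card_ffun.
rewrite -(card_imset _ h_inj); apply: eq_card => f; rewrite inE.
apply/idP/imsetP => [|[g _ ->]].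
  move=> /forallP fr; exists [ffun u => f (xchoose (exU u))] => //.
  apply/ffunP => x; rewrite !ffunE; apply/eqP.
  have := xchooseP (exU (exist _ (r x) (rU x))); rewrite eq_sym => e.
  exact: (implyP (forallP (fr _) _) e).
apply/forallP => x; apply/forallP => y; apply/implyP => /eqP e.
by rewrite !ffunE; apply/eqP; congr (g _); apply: val_inj.
Qed.

Lemma card_two_to_one (A B : finType) (D : {set A}) (f : A -> B) :
  (forall a, a \in D -> #|[set a' in D | f a' == f a]| = 2) ->
  #|D| = #|f @: D| * 2.
Proof.
move=> h; rewrite -sum1_card (partition_big_imset f) /= -sum_nat_const.
apply: eq_bigr => b /imsetP[a aD ->]; rewrite -(h a aD) -sum1_card.
by apply: eq_bigl => x; rewrite inE.
Qed.

Lemma porbit_invariant (T : finType) (S : Type) (s : {perm T}) (f : T -> S) :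
  (forall x, f (s x) = f x) -> forall x y, y \in porbit s x -> f y = f x.
Proof.
move=> fs x y /porbitP[k ->]; rewrite permX.
by elim: k => //= k IH; rewrite fs.
Qed.

Lemma card_porbits_fpf (T : finType) (t : {perm T}) :
  (forall x, t (t x) = x) -> (forall x, t x != x) -> #|T| = #|porbits t| * 2.
Proof.
move=> tt tn; have -> : porbits t = porbit t @: [set: T].
  by apply/setP => A; apply/imsetP/imsetP => -[x _ ->]; exists x.
rewrite -cardsT; apply: card_two_to_one.
move=> x _; have <- : #|[set x; t x]| = 2 by rewrite cards2 eq_sym tn.
apply: eq_card => y; rewrite !inE /= eq_porbit_mem; apply/porbitP/orP.
  move=> [k ->]; rewrite permX; elim: k => [|k IH]; first by left.
  by case: IH => /= /eqP ->; [right|left; rewrite tt].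
by case=> /eqP ->; [exists 0; rewrite expg0 perm1|exists 1; rewrite expg1].
Qed.

(** * Products of two fixed-point-free involutions *)

Section TwoInvolutions.
Variables (T : finType) (t u : {perm T}).
Hypotheses (tt : forall x, t (t x) = x) (uu : forall x, u (u x) = x).
Hypotheses (tn : forall x, t x != x) (un : forall x, u x != x).
Let p : {perm T} := (u * t)%g.
Let pE x : p x = t (u x). Proof. by rewrite permM. Qed.

(** [t] conjugates [p] to its inverse, so it maps cycles of [p] to cycles and reverses their
    direction. *)
Let conj_iter k x : t (iter k p (t (iter k p x))) = x.
Proof.
elim: k x => [|k IH] x; first by rewrite /= tt.
rewrite iterS [iter k.+1 p x]iterSr -[iter k p (t _)]tt IH.
by rewrite !pE !tt uu.
Qed.

Let t_porbit x y : y \in porbit p x -> t y \in porbit p (t x).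
Proof.
move=> /porbitP[k ->]; rewrite porbit_sym; apply/porbitP; exists k.
by rewrite !permX -[RHS]tt conj_iter.
Qed.

(** If [t x] were [p^k x], moving half of the steps to the other side by [conj_iter] would give a
    fixed point of [t] for k even and of [u] for k odd. *)
Let t_free x : t x \notin porbit p x.
Proof.
apply/negP => /porbitP[k]; rewrite permX.
have inj_it m : injective (iter m p).
  by elim: m => // m IH a b /= /perm_inj /IH.
have := odd_double_half k; case: (odd k) => /= <- e; last first.
  rewrite add0n -addnn iterD in e.
  have := conj_iter k./2 x; move/(congr1 t); rewrite tt e => /inj_it.
  by move/eqP; rewrite (negbTE (tn _)).
rewrite add1n -addnn -addSn addnC iterD in e.
have := conj_iter k./2.+1 x; move/(congr1 t); rewrite tt e.
rewrite [LHS]iterSr => /inj_it; rewrite pE => /(congr1 t); rewrite tt => /eqP.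
by rewrite (negbTE (un _)).
Qed.

(** A cycle of [p] and its mirror image; their union is an orbit of the group generated by [t] and
    [u]. For gluings these orbits are the vertices. *)
Let cls (A : {set T}) : {set {set T}} := [set A; t @: A].

Let t_imset x : t @: porbit p x = porbit p (t x).
Proof.
apply/setP => y; apply/imsetP/idP => [[z /t_porbit zx ->]//|yx].
by exists (t y); rewrite ?tt // -[x]tt; exact: t_porbit.
Qed.

Let clsE x : cls (porbit p x) = [set porbit p x; porbit p (t x)].
Proof. by rewrite /cls t_imset. Qed.

Lemma card_porbits_two_involutions :
  #|porbits p| = #|[set cls (porbit p x) | x : T]| * 2.
Proof.
rewrite (card_two_to_one (f := cls)); first by rewrite -imset_comp.
move=> A /imsetP[x _ ->].
have neq : porbit p x != porbit p (t x).
  by rewrite eq_sym eq_porbit_mem t_free.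
have <- : #|cls (porbit p x)| = 2 by rewrite clsE cards2 neq.
apply: eq_card => B; rewrite !inE t_imset clsE; apply/andP/orP.
  move=> [/imsetP[y _ ->]]; rewrite clsE => /eqP /setP /(_ (porbit p y)).
  by rewrite !inE eqxx /= => /esym/orP.
case=> /eqP ->; (split; first exact: imset_f).
  by rewrite clsE.
by rewrite clsE tt setUC.
Qed.

(** Such an [f] is a function on the orbits of the group generated by [t] and [u], each of which
    consists of exactly two cycles of [p]. *)
Lemma card_ffun_two_involutions N :
  #|[set f : {ffun T -> 'I_N} | [forall x, (f (t x) == f x) && (f (u x) == f x)]]|
  = N ^ (#|porbits p|./2).
Proof.
rewrite card_porbits_two_involutions muln2 doubleK -card_ffun_fiber.
apply: eq_card => f; rewrite !inE; apply/forallP/forallP => h x.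
  apply/forallP => y; apply/implyP; rewrite !clsE => /eqP /setP /(_ (porbit p x)).
  rewrite !inE eqxx /= => /esym.
  have fp z : f (p z) = f z.
    by rewrite pE (eqP (andP (h _)).1) (eqP (andP (h _)).2).
  case/orP; rewrite eq_porbit_mem => /(porbit_invariant fp) ->//.
  by rewrite (eqP (andP (h _)).1).
have tE : cls (porbit p (t x)) = cls (porbit p x) by rewrite !clsE tt setUC.
have uE : cls (porbit p (u x)) = cls (porbit p x).
  have e1 : porbit p (u x) = porbit p (t x).
    apply/eqP; rewrite eq_porbit_mem porbit_sym; apply/porbitP; exists 1.
    by rewrite expg1 pE uu.
  have e2 : porbit p (t (u x)) = porbit p x.
    apply/eqP; rewrite eq_porbit_mem; apply/porbitP; exists 1.
    by rewrite expg1 pE.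
  by rewrite !clsE e1 e2 setUC.
rewrite (implyP (forallP (h (t x)) x)) ?tE//.
by rewrite (implyP (forallP (h (u x)) x)) ?uE.
Qed.

End TwoInvolutions.

Lemma card_ffun_invariant (T : finType) (s : {perm T}) N :
  #|[set f : {ffun T -> 'I_N} | [forall x, f (s x) == f x]]| = N ^ #|porbits s|.
Proof.
rewrite -card_ffun_fiber; apply: eq_card => f; rewrite !inE.
apply/forallP/forallP => h x.
  apply/forallP => y; apply/implyP; rewrite eq_porbit_mem => xy; apply/eqP.
  by apply: porbit_invariant xy => z; exact/eqP.
apply: (implyP (forallP (h (s x)) x)).
by rewrite eq_porbit_mem -[s x]/((s ^+ 1)%g x) mem_porbit.
Qed.

(** * Effect of transpositions on the number of cycles *)

Definition moved (T : finType) (t : {perm T}) : {set T} := [set x | t x != x].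

Section SplitPair.
Variables (T : finType) (t : {perm T}) (x : T).
Hypotheses (tt : forall y, t (t y) = y) (tx : t x != x).
(** [t] with the pair {x, t x} replaced by two fixed points; inductions on involutions peel off one
    pair at a time. *)
Let t' : {perm T} := (t * tperm x (t x))%g.

Let t'E y : t' y = if (y == x) || (y == t x) then y else t y.
Proof.
rewrite permM; case: tpermP.
- move=> e; have -> : y = t x by rewrite -e tt.
  by rewrite eqxx orbT.
- by move=> /perm_inj ->; rewrite eqxx.
- move=> /eqP h1 /eqP h2.
  have -> : (y == x) = false.
    by apply/negbTE; apply: contra h2 => /eqP ->.
  have -> // : (y == t x) = false.
  by apply/negbTE; apply: contra h1 => /eqP ->; rewrite tt.
Qed.

Lemma split_pair_invol y : t' (t' y) = y.
Proof.
rewrite [t' y]t'E; case: ifP => h; first by rewrite t'E h.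
rewrite t'E; case: ifP => // h'; move/negbT/norP: h => [h1 h2]; move: h'.
by case/orP => /eqP e; [rewrite -e tt eqxx in h2|move/perm_inj: e h1 => ->; rewrite eqxx].
Qed.

Lemma card_moved_split_pair : #|moved t| = #|moved t'| + 2.
Proof.
have -> : moved t = moved t' :|: [set x; t x].
  apply/setP => y; rewrite !inE t'E; case: ifP => [|_]; last by rewrite orbF.
  by rewrite eqxx /= => /orP[] /eqP ->; rewrite ?tt ?tx// eq_sym tx.
rewrite cardsU cards2 eq_sym tx.
have -> : moved t' :&: [set x; t x] = set0.
  apply/setP => y; rewrite !inE t'E andbC.
  by case: ifP => //; rewrite eqxx andbF.
by rewrite cards0 subn0.
Qed.

Lemma split_pairE : t = (t' * tperm x (t x))%g.
Proof. by rewrite /t' -mulgA tperm2 mulg1. Qed.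

End SplitPair.

Lemma card_porbits_tperm_le (T : finType) (s : {perm T}) x y :
  #|porbits (tperm x y * s)| <= #|porbits s| + 1.
Proof.
have /= := porbits_mul_tperm s x y.
by move: (_.*2) => k; case: (x != y) => /=; lia.
Qed.

(** [t] is a product of half of [#|moved t|] transpositions, each of which raises the number of
    cycles by at most one. *)
Lemma card_porbits_invol (T : finType) (s t : {perm T}) :
  (forall x, t (t x) = x) ->
  2 * #|porbits (t * s)| <= 2 * #|porbits s| + #|moved t|.
Proof.
move: {2}#|moved t| (leqnn #|moved t|) => k.
elim: k s t => [|k IH] s t hk tt.
  have -> : t = 1%g.
    apply/permP => x; rewrite perm1; apply/eqP/negPn/negP => h.
    by move: hk; rewrite leqn0 cards_eq0 => /eqP/setP/(_ x); rewrite !inE h.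
  by rewrite mul1g leq_addr.
have [e0|[x]] := set_0Vmem (moved t).
  by apply: IH => //; rewrite e0 cards0.
rewrite inE => tx; have hc := card_moved_split_pair tt tx.
rewrite {1}(split_pairE t x) -mulgA.
have hk' : #|moved (t * tperm x (t x))%g| <= k by lia.
apply: leq_trans (IH (tperm x (t x) * s)%g _ hk' (split_pair_invol x tt)) _.
have := card_porbits_tperm_le s x (t x).
rewrite -(leq_pmul2l (m := 2)) // mulnDr => h.
by apply: leq_trans (leq_add h (leqnn _)) _; lia.
Qed.

(** The transposition of [x] and [t x] joins two distinct cycles of [s], so it lowers the count by
    one where [card_porbits_invol] allows a rise by one: a gain of 2, doubled to 4. *)
Lemma card_porbits_invol_through (T : finType) (s t : {perm T}) x :
  (forall x, t (t x) = x) -> x \notin porbit s (t x) ->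
  2 * #|porbits (t * s)| + 4 <= 2 * #|porbits s| + #|moved t|.
Proof.
move=> tt hx.
have tx : t x != x by apply: contraNneq hx => ->; exact: porbit_id.
have hc := card_moved_split_pair tt tx.
rewrite {1}(split_pairE t x) -mulgA.
have hA : #|porbits (tperm x (t x) * s)%g| + 2 = #|porbits s| + 1.
  by move: (porbits_mul_tperm s x (t x)); rewrite /= hx eq_sym tx.
have h := card_porbits_invol (tperm x (t x) * s)%g (split_pair_invol x tt).
by apply: leq_trans (leq_add h (leqnn _)) _; lia.
Qed.

End PermCounting.

(** * Gluings of a polygon *)

Section Gluings.
Local Open Scope nat_scope.

(** Pairs of equal sign identify two edges untwisted, as on an orientable surface; through pairs
    identify them with a twist. *)
Definition gluing (n : nat) : {set {perm pm n}} :=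
  [set rho : {perm pm n} | [forall x, [&& rho (rho x) == x, rho x != x,
     rho x != pm_opp x & rho (pm_opp x) == pm_opp (rho x)]]].

Lemma gluingP n (rho : {perm pm n}) :
  reflect [/\ forall x, rho (rho x) = x, forall x, rho x != x,
              forall x, rho x != pm_opp x
            & forall x, rho (pm_opp x) = pm_opp (rho x)]
          (rho \in gluing n).
Proof.
rewrite inE; apply: (iffP forallP) => [h|[h1 h2 h3 h4] x].
  by split=> x; have /and4P[/eqP h1 h2 h3 /eqP h4] := h x.
by rewrite h1 h2 h3 h4 !eqxx.
Qed.

Lemma pm_oppK n : involutive (@pm_opp n).
Proof. by move=> [b i]; rewrite /pm_opp /= negbK. Qed.

Definition vertex_cycles n (rho : {perm pm n}) : nat :=
  #|porbits (compr (annulus_perm n) rho)|.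

(* Edge r of the polygon joins the vertices i_r and i_(r+1), so [vertex_of i x]
   is the starting vertex of the edge x traversed in its own direction. *)
Definition vertex_of n N (i : 'I_n -> 'I_N) (x : pm n) : 'I_N :=
  i (if x.1 then ordS x.2 else x.2).

(** Exchanges the two directed edges that leave the same corner of the polygon; by [annulusE],
    [annulus_perm] is this involution after delta. *)
Definition vertex_swap n (x : pm n) : pm n :=
  if x.1 then (false, ordS x.2) else (true, ord_pred x.2).

Lemma vertex_swapK n : involutive (@vertex_swap n).
Proof. by move=> [[] i]; rewrite /vertex_swap /= ?ord_predK ?ordSK. Qed.

Lemma annulusE n (x : pm n) : annulus_perm n x = vertex_swap (pm_opp x).
Proof.
have dE y : delta_perm n y = pm_opp y by rewrite permE.
have gE y : gamma_perm n y = gamma_fun y by rewrite permE.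
rewrite /annulus_perm /compr !permM !dE gE.
case: x => [[] i]; rewrite /pm_opp /=; last first.
  have -> : ((gamma_perm n)^-1)%g (true, i) = (true, i).
    by apply: (canLR (permK _)); rewrite gE.
  by [].
have -> : ((gamma_perm n)^-1)%g (false, i) = (false, ord_pred i).
  by apply: (canLR (permK _)); rewrite gE /gamma_fun /= ord_predK.
by [].
Qed.

Section OneGluing.
Variables (n : nat) (rho : {perm pm n}).
Hypothesis rhoP : rho \in gluing n.

(** The two involutions whose product is the permutation counted by [vertex_cycles]: [sig] relates
    directed edges whose starting points are glued, [tau] turns around a corner. *)
Let sig : {perm pm n} := (rho * delta_perm n)%g.
Let tau : {perm pm n} := perm (can_inj (@vertex_swapK n)).

Let sigE x : sig x = pm_opp (rho x). Proof. by rewrite permM permE. Qed.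
Let tauE x : tau x = vertex_swap x. Proof. by rewrite permE. Qed.

Let cyclesE : compr (annulus_perm n) rho = (sig * tau)%g.
Proof. by apply/permP => x; rewrite /compr permM [RHS]permM sigE tauE annulusE. Qed.

Let tt x : tau (tau x) = x. Proof. by rewrite !tauE vertex_swapK. Qed.
Let tn x : tau x != x. Proof. by rewrite tauE; case: x => [[] i]. Qed.
Let ss x : sig (sig x) = x.
Proof. by have [h1 h2 h3 h4] := gluingP _ rhoP; rewrite !sigE h4 pm_oppK h1. Qed.
Let sn x : sig x != x.
Proof.
have [h1 h2 h3 h4] := gluingP _ rhoP.
by rewrite sigE; apply: contra (h3 x) => /eqP {2}<-; rewrite pm_oppK.
Qed.

Lemma vertex_cycles_even : ~~ odd (vertex_cycles rho).
Proof.
by rewrite /vertex_cycles cyclesE card_porbits_two_involutions // muln2 odd_double.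
Qed.

(** The [tau]-invariant functions on [+-n] are exactly the [vertex_of i], and compatibility with
    [rho] is invariance under [sig]: a compatible label is a function on the vertices of the glued
    surface. *)
Lemma card_compatible_labels N :
  #|[set i : {ffun 'I_n -> 'I_N} |
      [forall x, vertex_of i x == vertex_of i (pm_opp (rho x))]]|
  = N ^ (vertex_cycles rho)./2.
Proof.
rewrite /vertex_cycles cyclesE -card_ffun_two_involutions //.
pose h (i : {ffun 'I_n -> 'I_N}) : {ffun pm n -> 'I_N} := [ffun x => vertex_of i x].
have h_inj : injective h.
  by move=> i j /ffunP e; apply/ffunP => r; have := e (false, r); rewrite !ffunE.
rewrite -(card_imset _ h_inj); apply: eq_card => f; rewrite inE.
apply/imsetP/forallP => [[i + ->] x|H].
  rewrite inE => /forallP /(_ x) /eqP e; rewrite !ffunE sigE -e eqxx andbT.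
  by rewrite tauE /vertex_of /vertex_swap; case: x {e} => [[] r] /=; rewrite ?ord_predK.
have fE : f = h [ffun r => f (false, r)].
  apply/ffunP => -[b r]; rewrite !ffunE /vertex_of ffunE /=.
  case: b => //; have /andP[/eqP <- _] := H (true, r).
  by rewrite tauE.
exists [ffun r => f (false, r)] => //; rewrite inE; apply/forallP => x.
have /andP[_] := H x; rewrite {1 2}fE !ffunE sigE => /eqP ->.
exact: eqxx.
Qed.

(** Forgetting signs leaves an involution of the n edges; it has no fixed point, since [rho] pairs
    no edge with itself ([h2]) or with its reversal ([h3]). *)
Lemma gluing_even : ~~ odd n.
Proof.
have [h1 h2 h3 h4] := gluingP _ rhoP.
pose q r := (rho (false, r)).2.
have h4' b r : rho (~~ b, r) = pm_opp (rho (b, r)) by rewrite -h4.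
have qE b r : (rho (b, r)).2 = q r by case: b => //; rewrite (h4' false).
have qq r : q (q r) = r.
  rewrite -(qE (rho (false, r)).1 (q r)) /q.
  by rewrite -surjective_pairing h1.
pose t : {perm 'I_n} := perm (can_inj qq).
have := @card_porbits_fpf _ t; rewrite card_ord => ->.
- by rewrite muln2 odd_double.
- by move=> r; rewrite !permE.
- move=> r; rewrite permE; apply/eqP => e.
  have := h2 (false, r); have := h3 (false, r).
  rewrite [rho _]surjective_pairing -/(q r) e /pm_opp /=.
  by case: (rho (false, r)).1; rewrite eqxx.
Qed.

End OneGluing.

Lemma val_iter_ordS n (k : nat) (i : 'I_n) : iter k (@ordS n) i = (i + k) %% n :> nat.
Proof.
elim: k => [|k IH]; first by rewrite addn0 modn_small.
by rewrite iterS /= IH -[in LHS]addn1 modnDml addn1 addnS.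
Qed.

Lemma iter_ordS0 n (i : 'I_n.+1) : iter i (@ordS n.+1) ord0 = i.
Proof. by apply: ord_inj; rewrite val_iter_ordS add0n modn_small. Qed.

Lemma card_porbits_ordS n :
  #|porbits (perm (@ordS_inj n.+1))| = 1.
Proof.
rewrite -[RHS](cards1 (porbit (perm (@ordS_inj n.+1)) ord0)).
apply: eq_card => A; rewrite inE; apply/imsetP/eqP => [[i _ ->]|->]; last by exists ord0.
apply/eqP; rewrite eq_porbit_mem; apply/porbitP; exists i.
rewrite permX -[in LHS](iter_ordS0 i).
by apply: eq_iter => j; rewrite permE.
Qed.

(** One cycle for each sign: iterates of [ordS] from [ord0] reach every index, and on the negative
    side the permutation runs backwards. *)
Lemma card_porbits_annulus n : #|porbits (annulus_perm n.+1)| <= 2.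
Proof.
pose O b := porbit (annulus_perm n.+1) (b, ord0).
have sub : porbits (annulus_perm n.+1) \subset [set O false; O true].
  apply/subsetP => A /imsetP[[b i] _ ->]; rewrite !inE.
  have itF k (j : 'I_n.+1) : iter k (annulus_perm n.+1) (false, j) = (false, iter k (@ordS _) j).
    by elim: k => //= k ->; rewrite annulusE.
  have itT k (j : 'I_n.+1) : iter k (annulus_perm n.+1) (true, iter k (@ordS _) j) = (true, j).
    elim: k j => // k IH j; rewrite iterSr iterS annulusE /vertex_swap /=.
    by rewrite ordSK IH.
  case: b; apply/orP; [right|left]; rewrite eq_porbit_mem.
    rewrite porbit_sym; apply/porbitP; exists i.
    by rewrite permX -{2}(iter_ordS0 i) itT.
  by apply/porbitP; exists i; rewrite permX itF iter_ordS0.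
by apply: leq_trans (subset_leq_card sub) _; rewrite cards2; case: (_ != _).
Qed.

Lemma annulus_sign n (x y : pm n) : y \in porbit (annulus_perm n) x -> y.1 = x.1.
Proof.
apply: porbit_invariant => {}x; rewrite annulusE.
by case: x => [[] i].
Qed.

(** A through pair links the two cycles of [annulus_perm], so the sharper bound applies: twice the
    number of cycles plus 4 is at most 2 * 2 + 2(n + 1). *)
Lemma vertex_cycles_through n (rho : {perm pm n.+1}) x : rho \in gluing n.+1 ->
  (rho x).1 != x.1 -> vertex_cycles rho <= n.+1.
Proof.
move=> /gluingP[h1 h2 h3 h4] rx.
have hx : x \notin porbit (annulus_perm n.+1) (rho x).
  by apply: contra rx => /annulus_sign ->.
have := card_porbits_invol_through h1 hx.
have := card_porbits_annulus n.
have : #|moved rho| <= 2 * n.+1.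
  by apply: leq_trans (max_card _) _; rewrite card_prod card_bool card_ord.
rewrite /vertex_cycles /compr; lia.
Qed.

(** Without through pairs [rho] is two copies of one pairing [t] of the edges, and V is the number
    of cycles of the product of [t] with the long cycle [c]. The bound comes from the transpositions
    of [t], the parity from signatures. *)
Lemma vertex_cycles_planar n (rho : {perm pm n.+1}) : rho \in gluing n.+1 ->
  (forall x, (rho x).1 = x.1) ->
  (vertex_cycles rho)./2 <= (n.+1)./2 + 1 /\
  odd (vertex_cycles rho)./2 = ~~ odd (n.+1)./2.
Proof.
move=> rhoP sgn; have [h1 h2 h3 h4] := gluingP _ rhoP.
pose q r := (rho (false, r)).2.
have rhoE b r : rho (b, r) = (b, q r).
  case: b; last by rewrite [LHS]surjective_pairing sgn.
  by have := h4 (false, r); rewrite /pm_opp /= => ->; rewrite sgn.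
have qq r : q (q r) = r by have := h1 (false, r); rewrite !rhoE => -[].
pose t : {perm 'I_n.+1} := perm (can_inj qq).
have tE r : t r = q r by rewrite permE.
have tt r : t (t r) = r by rewrite !tE.
have tn r : t r != r.
  by rewrite tE; apply: contra (h2 (false, r)) => /eqP e; rewrite rhoE e.
pose c : {perm 'I_n.+1} := perm (@ordS_inj n.+1).
have VE : (vertex_cycles rho)./2 = #|porbits (t * c)%g|.
  (* Both numbers are exponents of 2 in the count of the same labellings by two values. *)
  apply: (@expnI 2) => //; rewrite -card_compatible_labels //.
  rewrite -card_ffun_invariant; apply: eq_card => i; rewrite !inE.
  apply/forallP/forallP => [H r|H [b r]].
    have := H (false, r); rewrite rhoE /vertex_of /= eq_sym.
    by rewrite permM tE [c _]permE.
  rewrite rhoE /vertex_of /=; case: b => /=.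
    by have := H (q r); rewrite permM tE qq [c _]permE.
  by have := H r; rewrite permM tE [c _]permE eq_sym.
have c1 : #|porbits c| = 1 by exact: card_porbits_ordS.
have nE := card_porbits_fpf tt tn; rewrite card_ord in nE.
split.
  have := card_porbits_invol c tt; rewrite c1 -VE.
  have : #|moved t| <= n.+1 by rewrite -[X in _ <= X]card_ord max_card.
  by lia.
(* The parity of a permutation is that of the number of points minus the number of cycles, and
   signatures multiply. *)
have := odd_permM t c; rewrite /odd_perm VE c1 card_ord.
have -> : (n.+1)./2 = #|porbits t| by move: #|porbits t| nE => m ->; rewrite muln2 doubleK.
have -> : odd n.+1 = false.
  by move: #|porbits t| nE => m ->; rewrite muln2 odd_double.
by rewrite /=; case: (odd #|porbits t|) => /=; case: (odd _).
Qed.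

Lemma vertex_cycles_le n (rho : {perm pm n.+1}) : rho \in gluing n.+1 ->
  (vertex_cycles rho)./2 <= (n.+1)./2 + 1.
Proof.
move=> rhoP; have [/existsP[x rx]|h] := boolP [exists x, (rho x).1 != x.1].
  by have := vertex_cycles_through rhoP rx; lia.
apply: (vertex_cycles_planar rhoP _).1 => x; apply/eqP.
by move/existsPn: h => /(_ x); rewrite negbK.
Qed.

(** The cycle count and the number of edges are both even, so comparing halves loses nothing.
    Conversely, without a through pair V would have the wrong parity. *)
Lemma NC2deltaE n : ~~ odd n.+1 ->
  NC2delta n.+1 = [set rho in gluing n.+1 | (vertex_cycles rho)./2 == (n.+1)./2].
Proof.
move=> ev; rewrite /NC2delta (negbTE ev); apply/setP => rho; rewrite [LHS]inE [RHS]inE.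
rewrite /nc_annular_pairing -/(vertex_cycles rho).
apply/and4P/andP => [[/and3P[/forallP h1 h2 /eqP h3] /eqP h4 /forallP h5 h6]|[rhoP e]].
  split; last by rewrite h3.
  apply/gluingP; split=> [x|x|x|x].
  - by have /andP[/eqP] := h1 x.
  - by have /andP[_] := h1 x.
  - exact: h5.
  - by have /permP/(_ x) := h4; rewrite /compr !permM !permE.
have fe : vertex_cycles rho = n.+1.
  by move: (vertex_cycles_even rhoP) ev (eqP e); lia.
have [k1 k2 k3 k4] := gluingP _ rhoP.
split.
- apply/and3P; split.
  + by apply/forallP => x; rewrite k1 eqxx k2.
  + apply: contraT => /existsPn H.
    have [] := vertex_cycles_planar rhoP.
      by move=> x; apply/eqP; have := H x; rewrite negbK.
    by rewrite (eqP e) => _; case: (odd _).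
  + exact/eqP.
- by apply/eqP/permP => x; rewrite /compr !permM !permE k4.
- exact/forallP.
- by apply/forallP => r; apply/forallP => s; apply/implyP => /eqP <-; rewrite k4.
Qed.

End Gluings.

Local Open Scope ring_scope.

(** * Polynomial functions and Gaussian integration by parts *)

Section Polynomials.
Variables (R : rcfType) (I : finType).
Implicit Types (m : {ffun I -> nat}) (x : I -> R).

Definition monom m x : R := \prod_b x b ^+ m b.

(** The formal partial derivative; at exponent 0 the truncated predecessor is harmless because the
    coefficient vanishes. *)
Definition dmonom (a : I) m x : R :=
  (m a)%:R * x a ^+ (m a).-1 * \prod_(b | b != a) x b ^+ m b.

Definition expo_add m m' : {ffun I -> nat} := [ffun b => (m b + m' b)%N].
Definition expo_pred (a : I) m : {ffun I -> nat} :=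
  [ffun b => if b == a then (m b).-1 else m b].
Definition expo_succ (a : I) m : {ffun I -> nat} :=
  [ffun b => if b == a then (m b).+1 else m b].

Lemma monomD m m' x : monom (expo_add m m') x = monom m x * monom m' x.
Proof. by rewrite -big_split; apply: eq_bigr => b _; rewrite ffunE exprD. Qed.

Lemma dmonomD a m m' x :
  dmonom a (expo_add m m') x = monom m x * dmonom a m' x + monom m' x * dmonom a m x.
Proof.
rewrite /monom /dmonom [X in X * _ + _](bigD1 a) //= [X in _ + X * _](bigD1 a) //= ffunE.
have -> : \prod_(b | b != a) x b ^+ expo_add m m' b =
  \prod_(b | b != a) x b ^+ m b * \prod_(b | b != a) x b ^+ m' b.
  by rewrite -big_split; apply: eq_bigr => b _; rewrite ffunE exprD.
set p := \prod_(b | b != a) x b ^+ m b; set q := \prod_(b | b != a) x b ^+ m' b.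
have e : (m a + m' a)%:R * x a ^+ (m a + m' a).-1 =
  x a ^+ m a * ((m' a)%:R * x a ^+ (m' a).-1) + x a ^+ m' a * ((m a)%:R * x a ^+ (m a).-1).
  case: (m a) (m' a) => [|i] [|j]; rewrite ?add0n ?addn0; try (rewrite /= ?mul0r; ring).
  by rewrite natrD addnS addSn /= !exprS exprD; ring.
by rewrite e; ring.
Qed.

Lemma dmonomE a m x : dmonom a m x = (m a)%:R * monom (expo_pred a m) x.
Proof.
rewrite /dmonom /monom (bigD1 a (P := xpredT)) //= ffunE eqxx mulrA; congr (_ * _).
by apply: eq_bigr => b /negbTE hb; rewrite ffunE hb.
Qed.

Lemma monom_succ a m x : monom (expo_succ a m) x = x a * monom m x.
Proof.
rewrite /monom (bigD1 a) //= ffunE eqxx exprS -mulrA; congr (_ * _).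
rewrite [RHS](bigD1 a) //=; congr (_ * _).
by apply: eq_bigr => b /negbTE hb; rewrite ffunE hb.
Qed.

(** Polynomial and gradient are read off one list of coefficients and exponents, so the derivative
    is purely algebraic and is again a polynomial. *)
Definition has_grad (f : (I -> R) -> R) (f' : I -> (I -> R) -> R) : Prop :=
  exists s : seq (R * {ffun I -> nat}),
    (forall x, f x = \sum_(p <- s) p.1 * monom p.2 x) /\
    (forall a x, f' a x = \sum_(p <- s) p.1 * dmonom a p.2 x).

Definition polyfun (f : (I -> R) -> R) : Prop := exists f', has_grad f f'.

Lemma has_grad_ext f1 f2 f1' f2' : f1 =1 f2 -> f1' =2 f2' ->
  has_grad f1 f1' -> has_grad f2 f2'.
Proof.
by move=> e e' [s [h h']]; exists s; split => [x|a x]; rewrite -?e -?e'.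
Qed.

Lemma has_grad_cst c : has_grad (fun=> c) (fun _ _ => 0).
Proof.
exists [:: (c, [ffun=> 0%N])]; split=> [x|a x]; rewrite big_seq1 /=.
  by rewrite /monom big1 ?mulr1// => b _; rewrite ffunE.
by rewrite /dmonom ffunE /= !mul0r mulr0.
Qed.

Lemma has_grad_var a : has_grad (fun x => x a) (fun b _ => (a == b)%:R).
Proof.
exists [:: (1, [ffun b => (a == b) : nat])]; split=> [x|b x]; rewrite big_seq1 /= mul1r.
  rewrite /monom (bigD1 a) //= ffunE eqxx big1 ?mulr1// => b.
  by rewrite ffunE eq_sym => /negbTE ->.
rewrite /dmonom ffunE; have [->|ab] := eqVneq a b; last by rewrite !mul0r.
by rewrite mul1r /= mul1r big1 // => c; rewrite ffunE eq_sym => /negbTE ->.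
Qed.

Lemma has_grad_add f g f' g' : has_grad f f' -> has_grad g g' ->
  has_grad (fun x => f x + g x) (fun a x => f' a x + g' a x).
Proof.
move=> [s [h h']] [t [k k']]; exists (s ++ t).
by split=> [x|a x]; rewrite big_cat /= ?h ?k ?h' ?k'.
Qed.

Lemma has_grad_mul f g f' g' : has_grad f f' -> has_grad g g' ->
  has_grad (fun x => f x * g x) (fun a x => f x * g' a x + g x * f' a x).
Proof.
move=> [s [h h']] [t [k k']].
exists [seq (p.1 * q.1, expo_add p.2 q.2) | p <- s, q <- t].
split=> [x|a x]; rewrite big_allpairs_dep /=.
  rewrite h k big_distrlr /=; apply: eq_bigr => p _; apply: eq_bigr => q _.
  by rewrite monomD; ring.
rewrite h k h' k' [X in _ + X]mulrC !big_distrlr -big_split /=; apply: eq_bigr => p _.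
rewrite -big_split /=; apply: eq_bigr => q _.
by rewrite dmonomD; ring.
Qed.

Lemma has_grad_scale c f f' : has_grad f f' ->
  has_grad (fun x => c * f x) (fun a x => c * f' a x).
Proof.
move=> hf; apply: has_grad_ext (has_grad_mul (has_grad_cst c) hf) => // a x.
by rewrite mulr0 addr0.
Qed.

Lemma has_grad_sum (J : Type) (s : seq J) (Q : pred J) (F : J -> (I -> R) -> R) F' :
  (forall j, has_grad (F j) (F' j)) ->
  has_grad (fun x => \sum_(j <- s | Q j) F j x) (fun a x => \sum_(j <- s | Q j) F' j a x).
Proof.
move=> hF; elim: s => [|j s IH].
  by apply: has_grad_ext (has_grad_cst 0) => [x|a x]; rewrite big_nil.
case Qj : (Q j).
  by apply: has_grad_ext (has_grad_add (hF j) IH) => [x|a x]; rewrite big_cons Qj.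
by apply: has_grad_ext IH => [x|a x]; rewrite big_cons Qj.
Qed.

Lemma polyfun_grad f f' a : has_grad f f' -> polyfun (f' a).
Proof.
move=> [s [_ h]]; eexists; exists [seq (p.1 * (p.2 a)%:R, expo_pred a p.2) | p : R * {ffun I -> nat} <- s].
split; last by move=> b x; reflexivity.
move=> x; rewrite h big_map; apply: eq_bigr => p _.
by rewrite dmonomE mulrA.
Qed.

End Polynomials.


Section GaussianFunctional.
Variables (R : rcfType) (I : finType).

(* The last clause is Stein's identity, i.e. Gaussian integration by parts. *)
Definition gaussian_functional (E : ((I -> R) -> R) -> R) : Prop :=
  [/\ forall f g, f =1 g -> E f = E g,
      E (fun=> 1) = 1,
      forall f g, polyfun f -> polyfun g -> E (fun x => f x + g x) = E f + E g,
      forall c f, polyfun f -> E (fun x => c * f x) = c * E f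
    & forall f f' a, has_grad f f' -> E (fun x => x a * f x) = E (f' a)].

Variable E : ((I -> R) -> R) -> R.
Hypothesis gE : gaussian_functional E.

Lemma expect_ext f g : f =1 g -> E f = E g. Proof. by case: gE => h _ _ _ _; exact: h. Qed.

Lemma expect_one : E (fun=> 1) = 1. Proof. by case: gE. Qed.

Lemma expect_add f g : polyfun f -> polyfun g ->
  E (fun x => f x + g x) = E f + E g.
Proof. by case: gE => _ _ h _ _; exact: h. Qed.

Lemma expect_scale c f : polyfun f -> E (fun x => c * f x) = c * E f.
Proof. by case: gE => _ _ _ h _; exact: h. Qed.

Lemma expect_stein f f' a : has_grad f f' -> E (fun x => x a * f x) = E (f' a).
Proof. by case: gE => _ _ _ _ h; exact: h. Qed.

Lemma polyfun_sum (J : Type) (s : seq J) (Q : pred J) (F : J -> (I -> R) -> R) :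
  (forall j, polyfun (F j)) -> polyfun (fun x => \sum_(j <- s | Q j) F j x).
Proof.
move=> hF; elim: s => [|j s [f' IH]].
  by eexists; apply: has_grad_ext (has_grad_cst _ 0) => [x|a x]; rewrite ?big_nil.
have [g' hg] := hF j; case Qj : (Q j).
  eexists; apply: has_grad_ext (has_grad_add hg IH); last by move=> a x; reflexivity.
  by move=> x; rewrite big_cons Qj.
eexists; apply: has_grad_ext IH; last by move=> a x; reflexivity.
by move=> x; rewrite big_cons Qj.
Qed.

Lemma polyfun_scale c f : polyfun f -> polyfun (fun x : I -> R => c * f x).
Proof. by move=> [f' h]; eexists; exact: (has_grad_scale c h). Qed.

Lemma polyfun_add f g : polyfun f -> polyfun g -> polyfun (fun x : I -> R => f x + g x).
Proof. by move=> [f' h] [g' k]; eexists; exact: (has_grad_add h k). Qed.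

Lemma expect_sum (J : Type) (s : seq J) (Q : pred J) (F : J -> (I -> R) -> R) :
  (forall j, polyfun (F j)) ->
  E (fun x => \sum_(j <- s | Q j) F j x) = \sum_(j <- s | Q j) E (F j).
Proof.
move=> hF; elim: s => [|j s IH].
  rewrite big_nil (@expect_ext _ (fun=> 0 * 1)).
    by rewrite expect_scale ?mul0r//; eexists; exact: has_grad_cst.
  by move=> x; rewrite big_nil mul0r.
rewrite big_cons; case Qj : (Q j).
  rewrite -IH -expect_add //; last exact: polyfun_sum.
  by apply: expect_ext => x; rewrite big_cons Qj.
by rewrite -IH; apply: expect_ext => x; rewrite big_cons Qj.
Qed.

End GaussianFunctional.

(** * Wick's formula *)

Section GoeMatrix.
Variables (R : rcfType) (N : nat).
Local Notation I := ('I_N * 'I_N)%type.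

Definition goe_mx (x : I -> R) : 'M[R]_N :=
  let G := \matrix_(i < N, j < N) x (i, j) in
  (Num.sqrt (2 * N)%:R)^-1 *: (G + G^T).

Definition goe_scale : R := (Num.sqrt (2 * N)%:R)^-1.
Local Notation s := goe_scale.

Lemma goe_mxE x i j : goe_mx x i j = s * (x (i, j) + x (j, i)).
Proof. by rewrite !mxE. Qed.

(** The variance factor of the entries; with the convention that 0 has inverse 0 it includes N =
    0. *)
Lemma goe_scale_sqr : 2 * (s * s) = N%:R^-1.
Proof.
rewrite /s -invfM -expr2 sqr_sqrtr ?ler0n// natrM invfM mulrA.
by rewrite divff ?mul1r// pnatr_eq0.
Qed.

Lemma goe_mx_sym x : (goe_mx x)^T = goe_mx x.
Proof. by apply/matrixP => i j; rewrite mxE !goe_mxE addrC. Qed.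

Lemma goe_pow_sym x k i j : (goe_mx x ^+ k) i j = (goe_mx x ^+ k) j i.
Proof.
suff e : (goe_mx x ^+ k)^T = goe_mx x ^+ k by rewrite -[in RHS]e mxE.
elim: k => [|k IH]; first by rewrite expr0 trmx1.
by rewrite exprS -mulmxE trmx_mul IH goe_mx_sym mulmxE -exprSr exprS.
Qed.

(** A unit vector. Since [goe_mx] is linear, its derivative in the variable [a] is the constant
    matrix [goe_mx (basis a)]. *)
Definition basis (a : I) (b : I) : R := (b == a)%:R.

Lemma has_grad_entry i j :
  has_grad (fun x => goe_mx x i j) (fun a _ => goe_mx (basis a) i j).
Proof.
apply: has_grad_ext (has_grad_scale s (has_grad_add (has_grad_var _ (i, j)) (has_grad_var _ (j, i)))).
  by move=> x; rewrite goe_mxE.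
by move=> a x; rewrite goe_mxE.
Qed.

Section Wick.
Variable E : ((I -> R) -> R) -> R.
Hypothesis gE : gaussian_functional E.

Lemma stein_entry F F' i j : has_grad F F' ->
  E (fun x => goe_mx x i j * F x) = s * (E (F' (i, j)) + E (F' (j, i))).
Proof.
move=> hF; rewrite -!(expect_stein gE _ hF).
have pv a : polyfun (fun x : I -> R => x a * F x).
  by eexists; exact: (has_grad_mul (has_grad_var _ a) hF).
rewrite -(expect_add gE) // -(expect_scale gE); last exact: polyfun_add.
by apply: (expect_ext gE) => x; rewrite goe_mxE; ring.
Qed.

Section Pairs.
Variables (n : nat) (u v : 'I_n -> 'I_N).

Definition entries_prod (S : {set 'I_n}) (x : I -> R) : R :=
  \prod_(r in S) goe_mx x (u r) (v r).

Lemma has_grad_entries_prod (S : {set 'I_n}) :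
  has_grad (entries_prod S)
    (fun a x => \sum_(r in S) goe_mx (basis a) (u r) (v r) * entries_prod (S :\ r) x).
Proof.
move: {2}#|S| (erefl #|S|) => k; elim: k S => [|k IH] S.
  move/eqP; rewrite cards_eq0 => /eqP ->.
  by apply: has_grad_ext (has_grad_cst _ 1) => [x|a x]; rewrite ?/entries_prod big_set0.
move=> hS; have [r rS] : exists r, r \in S by apply/card_gt0P; rewrite hS.
have hS' : #|S :\ r| = k by move: hS; rewrite (cardsD1 r) rS => -[].
apply: has_grad_ext (has_grad_mul (has_grad_entry (u r) (v r)) (IH _ hS')) => [x|a x].
  by rewrite /entries_prod [RHS](big_setD1 r).
rewrite [RHS](big_setD1 r) //= [LHS]addrC; congr (_ + _); first exact: mulrC.
rewrite mulr_sumr; apply: eq_bigr => q; rewrite !inE => /andP[qr qS].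
rewrite /entries_prod [in RHS](big_setD1 r) /=; last by rewrite !inE eq_sym qr rS.
by rewrite !setDDl setUC mulrCA.
Qed.

(** N times the covariance of the matrix entries attached to [r] and [q]. The two terms are the
    twisted and the untwisted gluing of these edges. *)
Definition pair_weight (r q : 'I_n) : R :=
  ((u r == u q) && (v r == v q))%:R + ((u r == v q) && (v r == u q))%:R.

(** Stein's identity for the factor [r]; Leibniz's rule then picks its partner [q]. *)
Lemma wick_step (S : {set 'I_n}) r : r \in S ->
  E (entries_prod S) =
  N%:R^-1 * \sum_(q in S :\ r) pair_weight r q * E (entries_prod (S :\ r :\ q)).
Proof.
move=> rS.
have hp S' : polyfun (entries_prod S') by eexists; exact: has_grad_entries_prod.
rewrite (@expect_ext _ _ _ gE _ (fun x => goe_mx x (u r) (v r) * entries_prod (S :\ r) x)); last first.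
  by move=> x; rewrite /entries_prod (big_setD1 r).
rewrite (stein_entry _ _ (has_grad_entries_prod (S :\ r))).
have Es a : E (fun x => \sum_(q in S :\ r) goe_mx (basis a) (u q) (v q) * entries_prod (S :\ r :\ q) x)
  = \sum_(q in S :\ r) goe_mx (basis a) (u q) (v q) * E (entries_prod (S :\ r :\ q)).
  rewrite (expect_sum gE); last by move=> q; exact: polyfun_scale.
  by apply: eq_bigr => q _; rewrite (expect_scale gE).
rewrite !Es -big_split !mulr_sumr; apply: eq_bigr => q _ /=.
rewrite -goe_scale_sqr !goe_mxE /basis /pair_weight !xpair_eqE.
rewrite [u q == _]eq_sym [v q == v r]eq_sym [v q == u r]eq_sym [u q == v r]eq_sym.
rewrite [(v r == u q) && _]andbC [(v r == v q) && _]andbC.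
by ring.
Qed.

End Pairs.
End Wick.
End GoeMatrix.

(** * Recursion for gluings of a set of edges *)

Section GluingSums.
Local Open Scope nat_scope.
Variable n : nat.

(** Partial gluings fix the points of all other edges, so they live in one group for every [S] and
    can be extended by multiplication. *)
Definition gluing_on (S : {set 'I_n}) : {set {perm pm n}} :=
  [set rho : {perm pm n} | [forall x, if x.2 \in S then
     [&& rho (rho x) == x, rho x != x, rho x != pm_opp x
       & rho (pm_opp x) == pm_opp (rho x)] else rho x == x]].

Lemma gluing_onT : gluing_on [set: 'I_n] = gluing n.
Proof.
by apply/setP => rho; rewrite !inE; apply: eq_forallb => x; rewrite inE.
Qed.

Lemma gluing_on0 : gluing_on set0 = [set 1%g].
Proof.
apply/setP => rho; rewrite !inE; apply/forallP/eqP => [h|-> x].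
  by apply/permP => x; have := h x; rewrite inE perm1 => /eqP.
by rewrite inE perm1.
Qed.

Lemma gluing_onP S (rho : {perm pm n}) : rho \in gluing_on S ->
  (forall x, x.2 \notin S -> rho x = x) /\
  (forall x, x.2 \in S -> [/\ rho (rho x) = x, rho x != x, rho x != pm_opp x,
       rho (pm_opp x) = pm_opp (rho x) & (rho x).2 \in S]).
Proof.
rewrite inE => /forallP h.
have out x : x.2 \notin S -> rho x = x.
  by move=> xS; have := h x; rewrite (negbTE xS) => /eqP.
split=> // x xS; have := h x; rewrite xS => /and4P[/eqP h1 h2 h3 /eqP h4]; split=> //.
by apply: contraT => /out e; move: h2; rewrite -e h1 eqxx.
Qed.

(** The involution exchanging r with y and -r with -y, which glues a single pair of edges. *)
Definition pair_swap (r : 'I_n) (y x : pm n) : pm n :=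
  if x.2 == r then (x.1 (+) y.1, y.2)
  else if x.2 == y.2 then (x.1 (+) y.1, r) else x.

Lemma pair_swapK r y : y.2 != r -> involutive (pair_swap r y).
Proof.
move=> yr [b q]; rewrite /pair_swap /=.
have [->|qr] := eqVneq q r; first by rewrite /= (negbTE yr) eqxx -addbA addbb addbF.
have [->|qy] := eqVneq q y.2; first by rewrite /= eqxx -addbA addbb addbF.
by rewrite /= (negbTE qr) (negbTE qy).
Qed.


Lemma pair_swap_opp r y x : pair_swap r y (pm_opp x) = pm_opp (pair_swap r y x).
Proof.
rewrite /pair_swap /pm_opp /=; case: (x.2 == r); first by rewrite addNb.
by case: (x.2 == y.2) => //; rewrite addNb.
Qed.

Section Step.
Variables (S : {set 'I_n}) (r : 'I_n) (y : pm n).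
Hypotheses (rS : r \in S) (yS : y.2 \in S) (yr : y.2 != r).
Let theta : {perm pm n} := perm (can_inj (pair_swapK yr)).
Let S' := S :\ r :\ y.2.
Let inD (x : pm n) := (x.2 == r) || (x.2 == y.2).

Let thetaE x : theta x = pair_swap r y x. Proof. by rewrite permE. Qed.
Let theta2 x : theta (theta x) = x. Proof. by rewrite !thetaE pair_swapK. Qed.
Let theta_opp x : theta (pm_opp x) = pm_opp (theta x).
Proof. by rewrite !thetaE pair_swap_opp. Qed.
Let theta_out x : ~~ inD x -> theta x = x.
Proof. by rewrite thetaE /pair_swap => /norP[/negbTE -> /negbTE ->]. Qed.
Let theta_in x : inD x -> inD (theta x) && ((theta x).2 != x.2).
Proof.
rewrite thetaE /pair_swap /inD; case: eqP => [->|/eqP xr] /=; first by rewrite eqxx orbT yr.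
by move=> /eqP ->; rewrite /= !eqxx eq_sym yr.
Qed.
Let theta_x0 : theta (false, r) = y.
Proof. by rewrite thetaE /pair_swap /= eqxx; case: y. Qed.

Let inS' x : (x.2 \in S') = (x.2 \in S) && ~~ inD x.
Proof. by rewrite !inE negb_or; case: (x.2 == r); case: (x.2 == y.2); case: (x.2 \in S). Qed.

Let inDS x : inD x -> x.2 \in S.
Proof. by case/orP => /eqP ->. Qed.

Let inDP x : inD x -> [\/ x = (false, r), x = (true, r), x = y | x = pm_opp y].
Proof.
case: x => b q; rewrite /inD /=; case/orP => /eqP ->; first by case: b; [constructor 2|constructor 1].
have [->|hb] := eqVneq b y.1; first by constructor 3; rewrite -surjective_pairing.
by constructor 4; rewrite /pm_opp; congr pair; move: hb; case: b; case: (y.1).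
Qed.

(** A gluing of [S'] and [theta] move disjoint sets of points, so multiplying by [theta] glues or
    unglues the edges of [r] and [y] and leaves the rest alone. *)
Lemma gluing_on_step (rho : {perm pm n}) :
  ((rho * theta)%g \in gluing_on S) && ((rho * theta)%g (false, r) == y) =
  (rho \in gluing_on S').
Proof.
apply/andP/idP => [[h /eqP hx0]|h].
  set ro := (rho * theta)%g in h hx0.
  have rhoE x : rho x = theta (ro x) by rewrite permM theta2.
  have [out inn] := gluing_onP h.
  have oppy : ro (true, r) = pm_opp y.
    by have [_ _ _ + _] := inn (false, r) rS; rewrite hx0.
  have roD x : inD x -> ro x = theta x.
    move=> /inDP[] ->.
    - by rewrite hx0 theta_x0.
    - by rewrite oppy -[(true, r)]/(pm_opp (false, r)) theta_opp theta_x0.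
    - by have [+ _ _ _ _] := inn (false, r) rS; rewrite hx0 -{3}theta_x0 theta2.
    - have [+ _ _ _ _] := inn (true, r) rS; rewrite oppy => ->.
      by rewrite theta_opp -theta_x0 theta2.
  have rhoD x : inD x -> rho x = x by move=> xD; rewrite rhoE roD // theta2.
  have roN x : ~~ inD x -> ~~ inD (ro x).
    move=> xD; have [xS|xS] := boolP (x.2 \in S); last by rewrite out.
    apply: contra xD => rD; have [e _ _ _ _] := inn x xS.
    by rewrite -e roD //; have /andP[] := theta_in rD.
  have rhoN x : ~~ inD x -> rho x = ro x.
    by move=> xD; rewrite rhoE theta_out // roN.
  rewrite inE; apply/forallP => x; rewrite inS'.
  have [xD|xD] := boolP (inD x); first by rewrite andbF rhoD.
  rewrite andbT; case: ifP => xS; last by rewrite rhoN // out ?xS.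
  have [h1 h2 h3 h4 _] := inn x xS.
  by rewrite (rhoN x) // (rhoN (ro x)) ?roN // rhoN // h1 h2 h3 h4 !eqxx.
have [out inn] := gluing_onP h.
have rhoD x : inD x -> rho x = x by move=> xD; rewrite out // inS' xD andbF.
have rhoN x : ~~ inD x -> ~~ inD (rho x).
  move=> xD; have [xS|xS] := boolP (x.2 \in S'); last by rewrite out.
  by have [_ _ _ _] := inn x xS; rewrite inS' => /andP[].
have roD x : inD x -> (rho * theta)%g x = theta x.
  by move=> xD; rewrite permM rhoD.
have roN x : ~~ inD x -> (rho * theta)%g x = rho x.
  by move=> xD; rewrite permM theta_out // rhoN.
split; last by rewrite roD ?theta_x0 // /inD eqxx.
rewrite inE; apply/forallP => x; have [xD|xD] := boolP (inD x).
  rewrite inDS // (roD x) //; have /andP[tD t2] := theta_in xD.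
  rewrite roD // theta2 eqxx roD // theta_opp eqxx andbT /=.
  by apply/andP; split; apply: contra t2 => /eqP ->.
rewrite (roN x) // roN ?rhoN // roN //.
have := inS' x; rewrite xD andbT; case: ifP => xS xS'.
  by have [h1 h2 h3 h4 _] := inn x xS'; rewrite h1 h2 h3 h4 !eqxx.
by rewrite out // xS'.
Qed.

Definition compatible (V : eqType) (A : {set 'I_n}) (rho : {perm pm n}) (a : pm n -> V) :=
  [forall x, (x.2 \in A) ==> (a x == a (pm_opp (rho x)))].

(** Of the four constraints at r, -r, y and -y, those at y and -y repeat those at -r and r. *)
Lemma compatible_step (V : eqType) (a : pm n -> V) (rho : {perm pm n}) :
  rho \in gluing_on S' ->
  compatible S (rho * theta)%g a =
  [&& a (false, r) == a (pm_opp y), a (true, r) == a y & compatible S' rho a].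
Proof.
move=> h; have [out inn] := gluing_onP h.
have rhoD x : inD x -> rho x = x by move=> xD; rewrite out // inS' xD andbF.
have rhoN x : ~~ inD x -> ~~ inD (rho x).
  move=> xD; have [xS|xS] := boolP (x.2 \in S'); last by rewrite out.
  by have [_ _ _ _] := inn x xS; rewrite inS' => /andP[].
have roD x : inD x -> (rho * theta)%g x = theta x.
  by move=> xD; rewrite permM rhoD.
have roN x : ~~ inD x -> (rho * theta)%g x = rho x.
  by move=> xD; rewrite permM theta_out // rhoN.
have D0 b : inD (b, r) by rewrite /inD eqxx.
have theta_x1 : theta (true, r) = pm_opp y.
  by rewrite -[(true, r)]/(pm_opp (false, r)) theta_opp theta_x0.
apply/forallP/and3P => [H|[/eqP H1 /eqP H2 /forallP H] x].
  split.
  - by have := H (false, r); rewrite rS roD // theta_x0.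
  - by have := H (true, r); rewrite rS roD // theta_x1 pm_oppK.
  - apply/forallP => x; apply/implyP; rewrite inS' => /andP[xS xD].
    by have := H x; rewrite xS roN.
apply/implyP => xS; have [xD|xD] := boolP (inD x); last first.
  by have := H x; rewrite inS' xS xD roN.
rewrite roD //; case: (inDP xD) => ->.
- by rewrite theta_x0 H1.
- by rewrite theta_x1 pm_oppK H2.
- by rewrite -{2}theta_x0 theta2 -H2.
- by rewrite theta_opp -{2}theta_x0 theta2 -H1.
Qed.

End Step.

(** Gluings are sorted by the partner [y] of the positive side of edge [r]. The two signs of [y]
    give the two terms of [pair_weight], so the sum obeys the recursion of [wick_step]. *)
Lemma sum_gluing_on (R : pzSemiRingType) (V : eqType) (a : pm n -> V) (S : {set 'I_n}) r :
  r \in S ->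
  (\sum_(rho in gluing_on S) (compatible S rho a)%:R =
   \sum_(q in S :\ r)
     (((a (false, r) == a (false, q)) && (a (true, r) == a (true, q)))%:R +
      ((a (false, r) == a (true, q)) && (a (true, r) == a (false, q)))%:R) *
     \sum_(rho in gluing_on (S :\ r :\ q)) (compatible (S :\ r :\ q) rho a)%:R :> R)%R.
Proof.
move=> rS.
rewrite (partition_big (fun rho : {perm pm n} => rho (false, r)) (fun y => y.2 \in S :\ r)) /=; last first.
  move=> rho /gluing_onP[_ inn]; have [_ h2 h3 _ h5] := inn (false, r) rS.
  rewrite !inE h5 andbT; move: h2 h3; case: (rho (false, r)) => b q /=.
  by rewrite /pm_opp /= !xpair_eqE; case: b => //=; rewrite andbT.
transitivity (\sum_(y : pm n | y.2 \in S :\ r)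
  ((a (false, r) == a (pm_opp y)) && (a (true, r) == a y))%:R *
  \sum_(rho in gluing_on (S :\ r :\ y.2)) (compatible (S :\ r :\ y.2) rho a)%:R : R)%R.
  apply: eq_bigr => y; rewrite !inE => /andP[yr yS].
  rewrite (reindex_inj (mulIg (perm (can_inj (pair_swapK yr))))) /=.
  rewrite (eq_bigl _ _ (gluing_on_step rS yS yr)) mulr_sumr.
  apply: eq_bigr => rho hrho; rewrite compatible_step //.
  by rewrite andbA -natrM mulnb.
pose F (b : bool) (q : 'I_n) : R := (((a (false, r) == a (~~ b, q)) && (a (true, r) == a (b, q)))%:R *
  \sum_(rho in gluing_on (S :\ r :\ q)) (compatible (S :\ r :\ q) rho a)%:R)%R.
rewrite (eq_bigr (fun y => F y.1 y.2)); last by move=> [b q] _.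
rewrite -(pair_big xpredT (fun q => q \in S :\ r) F) big_bool -big_split /=.
by apply: eq_bigr => q _; rewrite /F /= mulrDl.
Qed.

End GluingSums.

(** * Traces of powers as sums over closed walks *)

Section Walks.
Variables (R : pzRingType) (N : nat) (A : 'M[R]_N).

(** [f] lists the vertices of a walk without its last one; the conditional supplies [q] where
    [inord r.+1] would be out of range. *)
Lemma mx_pow_walk n p q :
  (A ^+ n.+1) p q = \sum_(f : {ffun 'I_n.+1 -> 'I_N} | f ord0 == p)
    \prod_(r < n.+1) A (f r) (if (r < n)%N then f (inord r.+1) else q).
Proof.
elim: n p q => [|n IH] p q.
  rewrite expr1 (big_pred1 [ffun=> p]); first by rewrite big_ord1 /= ffunE.
  move=> f /=; apply/eqP/eqP => [e|->]; last by rewrite ffunE.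
  by apply/ffunP => i; rewrite ffunE ord1.
(* [h] prepends the starting point [p] to a walk, [h'] drops the first point. *)
pose h (f : {ffun 'I_n.+1 -> 'I_N}) : {ffun 'I_n.+2 -> 'I_N} :=
  [ffun i => if unlift ord0 i is Some j then f j else p].
pose h' (f : {ffun 'I_n.+2 -> 'I_N}) : {ffun 'I_n.+1 -> 'I_N} :=
  [ffun j => f (lift ord0 j)].
have h0 f : h f ord0 = p by rewrite ffunE unlift_none.
have hS f j : h f (lift ord0 j) = f j by rewrite ffunE liftK.
rewrite [RHS](reindex_onto h h') /=; last first.
  move=> f /eqP e; apply/ffunP => i; rewrite !ffunE.
  by case: unliftP => [j ->|->]; rewrite ?ffunE.
rewrite [RHS](eq_bigl xpredT); last first.
  move=> f; rewrite h0 eqxx /=; apply/eqP/ffunP => j.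
  by rewrite ffunE hS.
rewrite exprS -mulmxE mxE [RHS](partition_big (fun f : {ffun 'I_n.+1 -> 'I_N} => f ord0) xpredT) //=.
apply: eq_bigr => l _; rewrite IH mulr_sumr; apply: eq_bigr => f /eqP fl.
rewrite [RHS]big_ord_recl h0 /=.
have -> : inord 1 = lift ord0 ord0 :> 'I_n.+2 by apply: ord_inj; rewrite inordK.
rewrite hS fl; congr (_ * _); apply: eq_bigr => i _; rewrite hS; congr (A _ _).
rewrite /bump /= add1n ltnS; case: ifP => // hi; rewrite -(hS f); congr (h f _).
by apply: ord_inj; rewrite /= /bump /= add1n !inordK // ltnS.
Qed.

Lemma mxtrace_pow_walk n :
  \tr (A ^+ n.+1) = \sum_(f : {ffun 'I_n.+1 -> 'I_N}) \prod_(r < n.+1) A (f r) (f (ordS r)).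
Proof.
rewrite [RHS](partition_big (fun f : {ffun 'I_n.+1 -> 'I_N} => f ord0) xpredT) //=.
apply: eq_bigr => p _; rewrite mx_pow_walk; apply: eq_bigr => f /eqP fp.
apply: eq_bigr => r _; congr (A _ _); case: ifP => hr.
  by congr (f _); apply: ord_inj; rewrite /= inordK ?ltnS // modn_small.
rewrite -fp; congr (f _); apply: ord_inj => /=.
have -> : nat_of_ord r = n by have := ltn_ord r; lia.
by rewrite modnn.
Qed.

End Walks.

(** * The genus expansion *)

Section GenusExpansion.
Variables (R : rcfType) (N : nat).
Local Notation I := ('I_N * 'I_N)%type.
Variable E : ((I -> R) -> R) -> R.
Hypothesis gE : gaussian_functional E.

Definition half_edge n (u v : 'I_n -> 'I_N) (x : pm n) : 'I_N :=
  if x.1 then v x.2 else u x.2.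

(** Both sides obey the same recursion, given by [wick_step] and [sum_gluing_on], with one factor
    1/N for each removed pair of edges. *)
Lemma wick_formula n (u v : 'I_n -> 'I_N) (S : {set 'I_n}) :
  E (entries_prod u v S) =
  N%:R^-1 ^+ (#|S|./2) *
    \sum_(rho in gluing_on S) (compatible S rho (half_edge u v))%:R.
Proof.
move: {2}#|S| (leqnn #|S|) => k; elim: k S => [|k IH] S hk; have [->|[r rS]] := set_0Vmem S.
- rewrite gluing_on0 big_set1 cards0 expr0 mul1r.
  have -> : compatible set0 1%g (half_edge u v) by apply/forallP => x; rewrite inE.
  rewrite -(expect_one gE); apply: (expect_ext gE) => x.
  by rewrite /entries_prod big_set0.
- by move: hk; rewrite leqn0 cards_eq0 => /eqP e; rewrite e inE in rS.
- rewrite gluing_on0 big_set1 cards0 expr0 mul1r.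
  have -> : compatible set0 1%g (half_edge u v) by apply/forallP => x; rewrite inE.
  rewrite -(expect_one gE); apply: (expect_ext gE) => x.
  by rewrite /entries_prod big_set0.
rewrite (wick_step gE _ _ rS) (sum_gluing_on _ _ rS) !mulr_sumr.
apply: eq_bigr => q qS.
have c1 : #|S| = (#|S :\ r :\ q|).+2 by rewrite (cardsD1 r) rS (cardsD1 q) qS.
rewrite IH; last by move: hk; rewrite c1; lia.
rewrite c1 /= exprS /pair_weight /half_edge /=.
by ring.
Qed.

(** Once the sums are exchanged, each gluing counts its compatible labels, which gives N^V. *)
Lemma expect_trace_pow n :
  E (fun x => N%:R^-1 * \tr (goe_mx x ^+ n.+1)) =
  N%:R^-1 * N%:R^-1 ^+ (n.+1)./2 *
    \sum_(rho in gluing n.+1) N%:R ^+ (vertex_cycles rho)./2.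
Proof.
have pe u v : polyfun (entries_prod (R := R) (N := N) (n := n.+1) u v [set: _]).
  by eexists; exact: has_grad_entries_prod.
rewrite (@expect_ext _ _ _ gE _ (fun x => N%:R^-1 * \sum_(f : {ffun 'I_n.+1 -> 'I_N})
   entries_prod f (fun r => f (ordS r)) [set: _] x)); last first.
  move=> x; congr (_ * _); rewrite mxtrace_pow_walk; apply: eq_bigr => f _.
  by apply: eq_bigl => r; rewrite inE.
rewrite (expect_scale gE); last exact: polyfun_sum.
rewrite (expect_sum gE) // -mulrA; congr (_ * _).
under eq_bigr => f _ do rewrite wick_formula cardsT card_ord gluing_onT.
rewrite -mulr_sumr exchange_big /=; congr (_ * _); apply: eq_bigr => rho hrho.
rewrite -natrX -card_compatible_labels // -sum1_card natr_sum [RHS]big_mkcond /=.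
apply: eq_bigr => f _; rewrite inE /compatible.
have -> : [forall x, (x.2 \in [set: 'I_n.+1]) ==>
    (half_edge f (fun r => f (ordS r)) x == half_edge f (fun r => f (ordS r)) (pm_opp (rho x)))]
  = [forall x, vertex_of f x == vertex_of f (pm_opp (rho x))].
  have e x : half_edge f (fun r => f (ordS r)) x = vertex_of f x.
    by rewrite /half_edge /vertex_of; case: x.1.
  by apply: eq_forallb => x; rewrite inE !e.
by case: ifP.
Qed.

End GenusExpansion.

(** * Schwinger-Dyson equations *)

Section SchwingerDyson.
Variables (R : rcfType) (N : nat).
Local Notation I := ('I_N * 'I_N)%type.
Local Notation s := (goe_scale R N).
Implicit Type x : I -> R.

Definition mtr (k : nat) x : R := N%:R^-1 * \tr (goe_mx x ^+ k).

(** Leibniz's rule for a matrix power: the factor after the first m is differentiated in the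
    variable [a]. *)
Definition dpow (k : nat) (a : I) x : 'M[R]_N :=
  \sum_(m < k) goe_mx x ^+ m * goe_mx (basis R a) * goe_mx x ^+ (k - m.+1).

Lemma dpowS k a x :
  dpow k.+1 a x = goe_mx (basis R a) * goe_mx x ^+ k + goe_mx x * dpow k a x.
Proof.
rewrite /dpow big_ord_recl expr0 mul1r subSS subn0; congr (_ + _).
rewrite mulr_sumr; apply: eq_bigr => m _.
by rewrite lift0 subSS exprS !mulrA.
Qed.

Lemma has_grad_pow k i j :
  has_grad (fun x => (goe_mx x ^+ k) i j) (fun a x => dpow k a x i j).
Proof.
elim: k i j => [|k IH] i j.
  apply: has_grad_ext (has_grad_cst _ ((1 : 'M[R]_N) i j)) => [x|a x]; first by rewrite expr0.
  by rewrite /dpow big_ord0 mxE.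
apply: has_grad_ext (has_grad_sum (index_enum 'I_N) xpredT
  (fun l => has_grad_mul (has_grad_entry R i l) (IH l j))) => [x|a x].
  by rewrite exprS -mulmxE mxE.
rewrite dpowS -!mulmxE [RHS]mxE ![in RHS]mxE big_split addrC /=; congr (_ + _).
by apply: eq_bigr => l _; rewrite mulrC.
Qed.

(** By symmetry of the powers, the two halves of each entry contribute equally; this exposes the
    bare variables [x (i, j)], to which Stein's identity applies. *)
Lemma mtr_succ k x :
  mtr k.+1 x = N%:R^-1 * (2 * s * \sum_i \sum_j x (i, j) * (goe_mx x ^+ k) i j).
Proof.
congr (_ * _); rewrite exprS -mulmxE.
transitivity (\sum_i \sum_j (s * (x (i, j) * (goe_mx x ^+ k) i j) + s * (x (j, i) * (goe_mx x ^+ k) j i))).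
  apply: eq_bigr => i _; rewrite mxE; apply: eq_bigr => j _.
  by rewrite goe_mxE [(goe_mx x ^+ k) i j]goe_pow_sym; ring.
under eq_bigr do rewrite big_split -!mulr_sumr /=.
rewrite big_split /= -!mulr_sumr [X in _ + s * X]exchange_big /=.
by ring.
Qed.

Lemma goe_mx_basis (i j : 'I_N) :
  goe_mx (basis R (i, j)) = s *: (delta_mx i j + delta_mx j i).
Proof.
apply/matrixP => p q; rewrite goe_mxE !mxE /basis !xpair_eqE.
by rewrite [(q == i) && _]andbC.
Qed.

Lemma mul_delta_mul (A B : 'M[R]_N) i j p q :
  (A *m delta_mx i j *m B) p q = A p i * B j q.
Proof.
rewrite mxE (bigD1 j) //= big1 => [|l lj].
  rewrite mxE (bigD1 i) //= big1 => [|l li].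
    by rewrite mxE !eqxx mulr1 !addr0.
  by rewrite mxE (negbTE li) mulr0.
rewrite mxE big1 ?mul0r // => l' _.
by rewrite mxE (negbTE lj) andbF mulr0.
Qed.

Lemma sum_entries_pow k l x :
  \sum_i \sum_j (goe_mx x ^+ k) i j * (goe_mx x ^+ l) i j = \tr (goe_mx x ^+ (k + l)).
Proof.
rewrite exprD -mulmxE; apply: eq_bigr => i _; rewrite mxE; apply: eq_bigr => j _.
by rewrite [X in _ * X]goe_pow_sym.
Qed.

(** The two terms of [goe_mx_basis] act differently: one splits the trace in two, the other, which
    comes from the transpose, leaves the single trace of power k - 1. *)
Lemma sum_dpow_diag k x :
  \sum_i \sum_j dpow k (i, j) x i j =
  s * \sum_(m < k) (\tr (goe_mx x ^+ m) * \tr (goe_mx x ^+ (k - m.+1)) +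
                    \tr (goe_mx x ^+ k.-1)).
Proof.
transitivity (\sum_i \sum_j \sum_(m < k) s *
  ((goe_mx x ^+ m) i i * (goe_mx x ^+ (k - m.+1)) j j +
   (goe_mx x ^+ m) i j * (goe_mx x ^+ (k - m.+1)) i j)).
  apply: eq_bigr => i _; apply: eq_bigr => j _; rewrite /dpow summxE.
  apply: eq_bigr => m _; rewrite goe_mx_basis -!mulmxE -scalemxAr -scalemxAl mxE.
  by rewrite mulmxDr mulmxDl mxE !mul_delta_mul.
under eq_bigr do rewrite exchange_big /=.
rewrite exchange_big /= mulr_sumr; apply: eq_bigr => m _.
under eq_bigr do rewrite -mulr_sumr big_split /= -mulr_sumr.
rewrite -mulr_sumr big_split /= -mulr_suml sum_entries_pow; congr (_ * (_ + \tr (_ ^+ _))).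
by have := ltn_ord m; lia.
Qed.

Lemma tr_dpow k i j x :
  \tr (dpow k (i, j) x) = k%:R * (2 * s * (goe_mx x ^+ k.-1) i j).
Proof.
rewrite /dpow raddf_sum /=.
rewrite (eq_bigr (fun=> 2 * s * (goe_mx x ^+ k.-1) i j)).
  by rewrite sumr_const card_ord [RHS]mulr_natl.
move=> m _; rewrite -!mulmxE mxtrace_mulC mulmxA !mulmxE -exprD.
have -> : (k - m.+1 + m)%N = k.-1 by have := ltn_ord m; lia.
set A := goe_mx x ^+ k.-1.
have td p q : \tr (A *m delta_mx p q) = A q p.
  rewrite -[A *m _]mulmx1 /mxtrace (bigD1 q) //= big1 => [|l lq].
    by rewrite mul_delta_mul mxE eqxx mulr1 addr0.
  by rewrite mul_delta_mul mxE eq_sym (negbTE lq) mulr0.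
rewrite goe_mx_basis -mulmxE -scalemxAr mxtraceZ mulmxDr mxtraceD !td.
by rewrite /A [X in s * (X + _)]goe_pow_sym; ring.
Qed.

Definition tprod (ks : seq nat) x : R := \prod_(k <- ks) mtr k x.

Fixpoint dtprod (ks : seq nat) (a : I) x : R :=
  if ks is l :: ks' then
    mtr l x * dtprod ks' a x + tprod ks' x * (N%:R^-1 * \tr (dpow l a x))
  else 0.

Lemma has_grad_mtr k : has_grad (mtr k) (fun a x => N%:R^-1 * \tr (dpow k a x)).
Proof.
exact: (has_grad_scale _ (has_grad_sum (index_enum 'I_N) xpredT (fun i => has_grad_pow k i i))).
Qed.

Lemma has_grad_tprod ks : has_grad (tprod ks) (dtprod ks).
Proof.
elim: ks => [|l ks IH].
  by apply: has_grad_ext (has_grad_cst _ 1) => [x|a x] //; rewrite /tprod big_nil.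
apply: has_grad_ext (has_grad_mul (has_grad_mtr l) IH) => [x|a x] //.
by rewrite /tprod big_cons.
Qed.

Lemma polyfun_tprod ks : polyfun (tprod ks).
Proof. by eexists; exact: has_grad_tprod. Qed.

(* The terms [(2 l_j, ks with l_j replaced by k + l_j - 1)] produced when
   the derivative falls on another trace. *)
Fixpoint cross (k : nat) (ks : seq nat) : seq (nat * seq nat) :=
  if ks is l :: ks' then
    ((2 * l)%N, (k + l.-1)%N :: ks') :: [seq (p.1, l :: p.2) | p <- cross k ks']
  else [::].

(** The derivative of [mtr l] is 2 s l / N times an entry of power l - 1; contraction with power k
    closes up to the trace of power k + l - 1. As 2 s^2 = 1/N, the coefficient is 2 l / N; it
    vanishes for l = 0. *)
Lemma cross_sum k ks x : (0 < N)%N ->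
  2 * s * \sum_i \sum_j (goe_mx x ^+ k) i j * dtprod ks (i, j) x =
  N%:R^-1 * \sum_(p <- cross k ks) p.1%:R * tprod p.2 x.
Proof.
move=> N0; elim: ks => [|l ks IH].
  rewrite big_nil mulr0 big1 ?mulr0// => i _; rewrite big1 // => j _.
  by rewrite mulr0.
rewrite /= big_cons big_map /= mulrDr.
have -> : \sum_(p <- cross k ks) p.1%:R * tprod (l :: p.2) x =
   mtr l x * \sum_(p <- cross k ks) p.1%:R * tprod p.2 x.
  rewrite mulr_sumr; apply: eq_bigr => p _; rewrite /tprod big_cons.
  by rewrite mulrCA.
rewrite [X in _ = _ + X]mulrCA -IH.
have -> : \sum_i \sum_j (goe_mx x ^+ k) i j *
     (mtr l x * dtprod ks (i, j) x + tprod ks x * (N%:R^-1 * \tr (dpow l (i, j) x))) =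
   mtr l x * (\sum_i \sum_j (goe_mx x ^+ k) i j * dtprod ks (i, j) x) +
   (tprod ks x * (N%:R^-1 * (l%:R * (2 * s)))) *
     \sum_i \sum_j (goe_mx x ^+ k) i j * (goe_mx x ^+ l.-1) i j.
  rewrite !mulr_sumr -big_split; apply: eq_bigr => i _ /=.
  rewrite !mulr_sumr -big_split; apply: eq_bigr => j _ /=.
  by rewrite tr_dpow; ring.
rewrite sum_entries_pow /tprod big_cons /mtr natrM -goe_scale_sqr.
by ring.
Qed.

Variable E : ((I -> R) -> R) -> R.
Hypothesis gE : gaussian_functional E.

(** The derivative of the k-th power gives the split traces and the 1/N term caused by the
    transpose. A derivative falling on another trace costs N^-2, hence the factorisation in the
    limit. *)
Lemma schwinger_dyson k ks : (0 < N)%N ->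
  E (tprod (k.+1 :: ks)) =
  \sum_(m < k) E (tprod [:: nat_of_ord m, (k - m.+1)%N & ks]) +
  k%:R * N%:R^-1 * E (tprod (k.-1 :: ks)) +
  N%:R^-1 ^+ 2 * \sum_(p <- cross k ks) p.1%:R * E (tprod p.2).
Proof.
move=> N0; have Nn0 : N%:R != 0 :> R by rewrite pnatr_eq0 -lt0n.
pose F i j x := (goe_mx x ^+ k) i j * tprod ks x.
pose F' i j a x := (goe_mx x ^+ k) i j * dtprod ks a x + tprod ks x * dpow k a x i j.
have hF i j : has_grad (F i j) (F' i j) by exact: (has_grad_mul (has_grad_pow k i j) (has_grad_tprod ks)).
pose c := N%:R^-1 * (2 * s).
transitivity (E (fun x => c * \sum_i \sum_j x (i, j) * F i j x)).
  apply: (expect_ext gE) => x; rewrite /tprod big_cons mtr_succ /c -!mulrA.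
  congr (_ * (_ * (_ * _))); rewrite mulr_suml; apply: eq_bigr => i _.
  by rewrite mulr_suml; apply: eq_bigr => j _; rewrite /F mulrA.
have pv a i j : polyfun (fun x => x a * F i j x).
  by eexists; exact: (has_grad_mul (has_grad_var _ a) (hF i j)).
have pF i j a : polyfun (F' i j a) by exact: polyfun_grad (hF i j).
transitivity (E (fun x => c * \sum_i \sum_j F' i j (i, j) x)).
  rewrite !(expect_scale gE); first last.
  - by apply: polyfun_sum => i; exact: polyfun_sum.
  - by apply: polyfun_sum => i; exact: polyfun_sum.
  rewrite !(expect_sum gE); first last.
  - by move=> i; exact: polyfun_sum.
  - by move=> i; exact: polyfun_sum.
  congr (_ * _); apply: eq_bigr => i _; rewrite !(expect_sum gE) //.
  by apply: eq_bigr => j _; rewrite (expect_stein gE _ (hF i j)).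
have p1 : polyfun (fun x => \sum_(m < k) tprod [:: nat_of_ord m, (k - m.+1)%N & ks] x).
  by apply: polyfun_sum => m; exact: polyfun_tprod.
have p2 : polyfun (fun x => k%:R * N%:R^-1 * tprod (k.-1 :: ks) x).
  by apply: polyfun_scale; exact: polyfun_tprod.
have p3 : polyfun (fun x => \sum_(p <- cross k ks) p.1%:R * tprod p.2 x).
  by apply: polyfun_sum => p; apply: polyfun_scale; exact: polyfun_tprod.
transitivity (E (fun x => \sum_(m < k) tprod [:: nat_of_ord m, (k - m.+1)%N & ks] x +
   k%:R * N%:R^-1 * tprod (k.-1 :: ks) x +
   N%:R^-1 ^+ 2 * \sum_(p <- cross k ks) p.1%:R * tprod p.2 x)).
  apply: (expect_ext gE) => x.
  have -> : \sum_i \sum_j F' i j (i, j) x =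
     \sum_i \sum_j (goe_mx x ^+ k) i j * dtprod ks (i, j) x +
     tprod ks x * \sum_i \sum_j dpow k (i, j) x i j.
    rewrite mulr_sumr -big_split; apply: eq_bigr => i _ /=.
    by rewrite mulr_sumr -big_split.
  rewrite mulrDr addrC {2}/c -[X in _ + X]mulrA cross_sum // mulrA -expr2.
  congr (_ + _); rewrite sum_dpow_diag.
  have trE l : \tr (goe_mx x ^+ l) = N%:R * mtr l x by rewrite /mtr mulVKf.
  have -> : \sum_(m < k) (\tr (goe_mx x ^+ m) * \tr (goe_mx x ^+ (k - m.+1)) +
         \tr (goe_mx x ^+ k.-1)) =
     N%:R ^+ 2 * (\sum_(m < k) mtr m x * mtr (k - m.+1)%N x) + k%:R * (N%:R * mtr k.-1 x).
    rewrite big_split /= sumr_const card_ord trE [k%:R * _]mulr_natl; congr (_ + _).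
    by rewrite mulr_sumr; apply: eq_bigr => m _; rewrite !trE; ring.
  have -> : \sum_(m < k) tprod [:: nat_of_ord m, (k - m.+1)%N & ks] x =
     (\sum_(m < k) mtr m x * mtr (k - m.+1)%N x) * tprod ks x.
    by rewrite mulr_suml; apply: eq_bigr => m _; rewrite /tprod !big_cons mulrA.
  rewrite [tprod (_ :: ks) x]/tprod big_cons -/(tprod ks x) /c.
  transitivity (N%:R^-1 * (2 * (s * s)) * (tprod ks x *
     (N%:R ^+ 2 * (\sum_(m < k) mtr m x * mtr (k - m.+1)%N x) + k%:R * (N%:R * mtr k.-1 x)))).
    by ring.
  by rewrite goe_scale_sqr; field.
rewrite (expect_add gE); [|exact: polyfun_add|exact: polyfun_scale].
rewrite (expect_add gE) // (expect_sum gE); last by move=> m; exact: polyfun_tprod.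
rewrite !(expect_scale gE) //; last exact: polyfun_tprod.
rewrite (expect_sum gE); last by move=> p; apply: polyfun_scale; exact: polyfun_tprod.
congr (_ + _ * _); apply: eq_bigr => p _.
by rewrite (expect_scale gE) //; exact: polyfun_tprod.
Qed.

(** Brings the cross terms within reach of an induction on the total degree. *)
Lemma cross_degree k ks p : p \in cross k ks -> (sumn p.2 < (k.+1 + sumn ks))%N.
Proof.
elim: ks p => [|l ks IH] p //; rewrite inE => /orP[/eqP ->|/mapP[q /IH h ->]].
  have -> : sumn ((2 * l)%N, (k + l.-1)%N :: ks).2 = (k + l.-1 + sumn ks)%N by [].
  have -> : sumn (l :: ks) = (l + sumn ks)%N by [].
  by lia.
have -> : sumn (q.1, l :: q.2).2 = (l + sumn q.2)%N by [].
have -> : sumn (l :: ks) = (l + sumn ks)%N by [].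
by lia.
Qed.

End SchwingerDyson.

From mathcomp Require Import all_classical all_reals all_analysis.
From mathcomp Require Import measurable_realfun.

Import numFieldNormedType.Exports.

Local Open Scope classical_set_scope.

(** * Moments of the semicircle law *)

Section Semicircle.
Variable R : realType.
Local Notation mu := (@lebesgue_measure R).

Lemma Rintegral_FTC2 (F f : R -> R) (a b : R) : a < b ->
  (forall x : R, is_derive x 1 F (f x)) -> continuous f ->
  \int[mu]_(x in `[a, b]) f x = F b - F a.
Proof.
move=> ab dF cf; rewrite /Rintegral (@continuous_FTC2 _ f F) //.
- exact: continuous_subspaceT.
- have cF : continuous F.
    by move=> x; apply/differentiable_continuous/derivable1_diffP; case: (dF x).
  split; [by move=> x _; case: (dF x)| |].
  + apply: cvg_at_right_filter; exact: cF.
  + apply: cvg_at_left_filter; exact: cF.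
- by move=> x _; rewrite derive1E; case: (dF x).
Qed.

Lemma is_derive_exprn (f : R -> R) n (x df : R) : is_derive x 1 f df ->
  is_derive x 1 (fun y => f y ^+ n) (n%:R * f x ^+ n.-1 * df).
Proof.
move=> h; have -> : (fun y => f y ^+ n) = (f ^+ n : R -> R).
  by apply/funext => y; elim: n => [|n IH]; rewrite ?expr0// !exprS IH.
exact: (is_deriveX n h).
Qed.

Lemma is_derive_mulr (f g : R -> R) (x df dg : R) :
  is_derive x 1 f df -> is_derive x 1 g dg ->
  is_derive x 1 (fun y => f y * g y) (f x * dg + g x * df).
Proof. by move=> h1 h2; exact: (is_deriveM h1 h2). Qed.

Lemma is_derive_mull (f : R -> R) (c x df : R) :
  is_derive x 1 f df -> is_derive x 1 (fun y => c * f y) (c * df).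
Proof. by move=> h; exact: (is_deriveZ c h). Qed.

(** The moment integral after x = 2 sin t, up to the factor 1/(2 pi): one cosine comes from the
    density, the other from dx. *)
Definition trig_moment (n : nat) : R :=
  \int[mu]_(x in `[- (pi / 2), pi / 2])
    ((2 * sin x) ^+ n * (2 * cos x) ^+ 2).

Let dS (x : R) : is_derive x 1 (fun y : R => 2 * sin y) (2 * cos x).
Proof.
exact: (is_derive_mull 2 (is_derive_sin x)).
Qed.

Let dC (x : R) : is_derive x 1 (fun y : R => 2 * cos y) (- (2 * sin x)).
Proof.
by apply: (is_derive_eq (is_derive_mull 2 (is_derive_cos x))); rewrite /GRing.scale/= mulrN.
Qed.

Let cS : continuous (fun y : R => 2 * sin y).
Proof. by move=> x; apply/differentiable_continuous/derivable1_diffP; case: (dS x). Qed.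

Let cC : continuous (fun y : R => 2 * cos y).
Proof. by move=> x; apply/differentiable_continuous/derivable1_diffP; case: (dC x). Qed.

Let cSC n m : continuous (fun x : R => (2 * sin x) ^+ n * (2 * cos x) ^+ m).
Proof.
move=> x; apply: cvgM.
  exact: (@continuous_comp _ _ _ (fun y : R => 2 * sin y) (fun z : R => z ^+ n) x
    (@cS x) (@exprn_continuous R n _)).
exact: (@continuous_comp _ _ _ (fun y : R => 2 * cos y) (fun z : R => z ^+ m) x
  (@cC x) (@exprn_continuous R m _)).
Qed.

Let ab : - (pi / 2) < pi / 2 :> R.
Proof. by have := @pi_gt0 R; lra. Qed.

Lemma integrable_trig n :
  mu.-integrable `[- (pi / 2), pi / 2] (EFin \o (fun x => (2 * sin x) ^+ n * (2 * cos x) ^+ 2)).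
Proof.
apply: continuous_compact_integrable; first exact: segment_compact.
exact/continuous_subspaceT/cSC.
Qed.

Lemma sqr_2cos (x : R) : (2 * cos x) ^+ 2 = 4 - (2 * sin x) ^+ 2.
Proof. by have := cos2Dsin2 x; rewrite !exprMn => h; nra. Qed.

(** With (2 cos)^2 = 4 - (2 sin)^2, the derivative of (2 sin)^(n+1) (2 cos)^3 is the difference of
    the two integrands, and this function vanishes at both ends. *)
Lemma trig_moment_rec n :
  n.+4%:R * trig_moment n.+2 = 4 * n.+1%:R * trig_moment n.
Proof.
have := @Rintegral_FTC2 (fun x => (2 * sin x) ^+ n.+1 * (2 * cos x) ^+ 3)
  (fun x => (4 * n.+1%:R) * ((2 * sin x) ^+ n * (2 * cos x) ^+ 2)
          - n.+4%:R * ((2 * sin x) ^+ n.+2 * (2 * cos x) ^+ 2)) _ _ ab.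
move=> /(_ _)/wrap[|].
  move=> x; apply: (is_derive_eq (is_derive_mulr (is_derive_exprn n.+1 (dS x)) (is_derive_exprn 3 (dC x)))).
  rewrite /GRing.scale /=; set s := 2 * sin x; set c := 2 * cos x.
  have -> : c ^+ 3 = (4 - s ^+ 2) * c by rewrite exprSr sqr_2cos.
  have e : c ^+ 2 = 4 - s ^+ 2 by rewrite sqr_2cos.
  rewrite !exprS.
  rewrite -[n.+4]addn3 -[n.+1]addn1 !natrD.
  have -> : c * (c * c ^+ 0) = 4 - s ^+ 2 by rewrite expr0 mulr1 -expr2.
  ring: e.
move=> /(_ _)/wrap[|].
  move=> x; apply: cvgB; apply: cvgM; try exact: cvg_cst; exact: cSC.
rewrite cos_pihalf cosN cos_pihalf mulr0 !expr0n /= !mulr0 subrr.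
rewrite RintegralB//.
- rewrite !RintegralZl//; [|exact: integrable_trig|exact: integrable_trig].
  by move/eqP; rewrite subr_eq0 => /eqP.
- by apply: (@integrableZl _ _ _ mu `[- (pi / 2), pi / 2] _ (4 * n.+1%:R) _ (integrable_trig n)).
- by apply: (@integrableZl _ _ _ mu `[- (pi / 2), pi / 2] _ n.+4%:R _ (integrable_trig n.+2)).
Qed.

Lemma trig_moment0 : trig_moment 0 = 2 * pi.
Proof.
(* The antiderivative is 2x + sin(2x). *)
have := @Rintegral_FTC2 (fun x => 2 * x + 2^-1 * ((2 * sin x) * (2 * cos x)))
  (fun x => (2 * sin x) ^+ 0 * (2 * cos x) ^+ 2) _ _ ab.
move=> /(_ _)/wrap[|].
  move=> x; apply: (is_derive_eq (is_deriveD (is_derive_mull 2 (is_derive_id x 1))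
    (is_derive_mull 2^-1 (is_derive_mulr (dS x) (dC x))))).
  rewrite /GRing.scale /= expr0 mul1r; have := sqr_2cos x.
  set s := 2 * sin x; set c := 2 * cos x; rewrite !expr2; lra.
move=> /(_ _)/wrap[|]; first exact: cSC.
rewrite /trig_moment => ->; rewrite cosN !cos_pihalf; lra.
Qed.

Lemma trig_moment1 : trig_moment 1 = 0.
Proof.
have := @Rintegral_FTC2 (fun x => - 3^-1 * (2 * cos x) ^+ 3)
  (fun x => (2 * sin x) ^+ 1 * (2 * cos x) ^+ 2) _ _ ab.
move=> /(_ _)/wrap[|].
  move=> x; apply: (is_derive_eq (is_derive_mull (- 3^-1) (is_derive_exprn 3 (dC x)))).
  rewrite /GRing.scale /= expr1. 
  set s := 2 * sin x; set c := 2 * cos x; rewrite !expr2; lra.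
move=> /(_ _)/wrap[|]; first exact: cSC.
rewrite /trig_moment => ->; rewrite cosN !cos_pihalf; lra.
Qed.

(** On the interval the substitution is increasing and the cosine nonnegative, so the square root of
    the density becomes 2 cos t. *)
Lemma semicircle_momentE n : semicircle_moment R n = (2 * pi)^-1 * trig_moment n.
Proof.
have F'E : (fun y : R => 2 * sin y)^`()%classic = (fun y => 2 * cos y).
  by apply/funext => x; rewrite derive1E; case: (dS x).
rewrite /trig_moment -RintegralZl //; last exact: integrable_trig.
rewrite /semicircle_moment /Rintegral.
have := @integration_by_substitution_increasing R (fun y : R => 2 * sin y)
 (fun x => x ^+ n * (Num.sqrt (4 - x ^+ 2) / (2 * pi))) _ _ (ltW ab).
rewrite sinN sin_pihalf mulr1 mulrN1 => ->.
- congr fine; apply: eq_integral => x; rewrite inE /= in_itv /= => xab.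
  congr EFin; rewrite F'E fctE /=.
  rewrite -sqr_2cos sqrtr_sqr ger0_norm ?mulr_ge0 ?cos_ge0_pihalf//.
  by rewrite expr2; ring.
- by move=> x y xab yab xy; rewrite ltr_pM2l// ltr_sin.
- by rewrite F'E => x _; exact: cC.
- by rewrite F'E; apply/cvg_ex; exists (2 * cos (- (pi / 2))); apply: cvg_at_right_filter; exact: cC.
- by rewrite F'E; apply/cvg_ex; exists (2 * cos (pi / 2)); apply: cvg_at_left_filter; exact: cC.
- split; [by move=> x _; case: (dS x)| |].
  + by apply: cvg_at_right_filter; exact: cS.
  + by apply: cvg_at_left_filter; exact: cS.
- apply: continuous_subspaceT => x.
  apply: cvgM; first exact: exprn_continuous.
  apply: cvgM; last exact: cvg_cst.
  apply: (@continuous_comp _ _ _ (fun y : R => 4 - y ^+ 2) Num.sqrt); last exact: sqrt_continuous.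
  by apply: cvgB; [exact: cvg_cst|exact: exprn_continuous].
Qed.

Lemma semicircle_moment_rec n :
  n.+4%:R * semicircle_moment R n.+2 = 4 * n.+1%:R * semicircle_moment R n.
Proof.
by rewrite !semicircle_momentE mulrCA trig_moment_rec; ring.
Qed.

Lemma semicircle_moment0 : semicircle_moment R 0 = 1.
Proof.
by rewrite semicircle_momentE trig_moment0 mulVf// mulf_neq0// gt_eqF// pi_gt0.
Qed.

Lemma semicircle_moment1 : semicircle_moment R 1 = 0.
Proof. by rewrite semicircle_momentE trig_moment1 mulr0. Qed.

End Semicircle.

(** * From a two-step recursion to the Catalan convolution *)

Section CatalanConvolution.
Variables (R : realType) (m : nat -> R).
Hypothesis m0 : m 0%N = 1.
Hypothesis m1 : m 1%N = 0.
Hypothesis mrec : forall n, n.+4%:R * m n.+2 = 4 * n.+1%:R * m n.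

Let S n := \sum_(i < n.+1) m i * m (n - i)%N.

(** Reflecting i to n - i replaces the weight i + 2 by the average (n + 4)/2. *)
Let wS n : \sum_(i < n.+1) (i.+2)%:R * (m i * m (n - i)%N) = (n.+4)%:R / 2 * S n.
Proof.
pose A := \sum_(i < n.+1) (i.+2)%:R * (m i * m (n - i)%N).
have AE : A = \sum_(i < n.+1) ((n - i).+2)%:R * (m i * m (n - i)%N).
  rewrite /A (reindex_inj rev_ord_inj) /=; apply: eq_bigr => i _.
  rewrite subSS subKn; last by rewrite -ltnS.
  by congr (_ * _); exact: mulrC.
have h : A + A = n.+4%:R * S n.
  rewrite {2}AE -big_split mulr_sumr; apply: eq_bigr => i _ /=.
  rewrite -mulrDl -natrD; congr (_%:R * _).
  by have := ltn_ord i; lia.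
rewrite -/A; lra.
Qed.

(** In [wS] at n + 2 the terms i = 0, 1 are split off; shifting the others by two turns the weight
    into i + 4, the left coefficient of [mrec], which reduces them to [wS] at n. The total is [mrec]
    for index n + 4. Steps of two call for two consecutive values in the induction. *)
Lemma catalan_convolution n : m n.+2 = \sum_(i < n.+1) m i * m (n - i)%N.
Proof.
rewrite -/(S n); suff [] : m n.+2 = S n /\ m n.+3 = S n.+1 by [].
elim: n => [|n [IH1 IH2]].
  have := mrec 0; have := mrec 1; rewrite m0 m1 => h1 h0.
  by split; rewrite /S !big_ord_recr !big_ord0 /= ?subn0 ?subnn m0 ?m1; lra.
split=> //.
have nz : (n.+2).+4%:R != 0 :> R by rewrite pnatr_eq0.
apply: (mulfI nz); rewrite mrec.
have := wS n.+2.
rewrite big_ord_recl big_ord_recl /= /bump /= !subn0 m0 m1.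
under eq_bigr => i _ do
  rewrite /bump !add1n !subSS mulrA mrec.
have -> : \sum_(i < n.+1) 4 * (i.+1)%:R * m i * m (n - i)%N =
   4 * (\sum_(i < n.+1) (i.+2)%:R * (m i * m (n - i)%N) - S n).
  rewrite /S -sumrB mulr_sumr; apply: eq_bigr => i _.
  by rewrite -[i.+2]addn1 natrD; ring.
rewrite wS -IH1.
have nE k : (k + n)%:R = n%:R + k%:R :> R by rewrite natrD addrC.
rewrite -/(S n.+2) (nE 6) (nE 3) (nE 4); lra.
Qed.

End CatalanConvolution.

(** * Independence and Gaussian moments *)

Lemma maxr_posBneg (R : realType) (x : R) : x = Num.max x 0 - Num.max (- x) 0.
Proof.
have [h|/ltW h] := leP x 0.
  by rewrite max_l ?oppr_ge0 // sub0r opprK.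
by rewrite max_r ?oppr_le0 // subr0.
Qed.

(** * From indicators to nonnegative integrands *)

Section Transfer.
Variable R : realType.
Import HBNNSimple.

Section OneSide.
Context (d : measure_display) (X : measurableType d).
Variables (mu : {measure set X -> \bar R}) (f H : X -> R).
Hypotheses (mf : measurable_fun setT f) (mH : measurable_fun setT H).
Hypothesis H0 : forall x, 0 <= H x.

Lemma integral_nnsfun_comp_mul (S : {nnsfun R >-> R}) :
  (\int[mu]_x (S (f x) * H x)%:E =
   \sum_(y \in range S)
     y%:E * \int[mu]_x (\1_(S @^-1` [set y]) (f x) * H x)%:E)%E.
Proof.
transitivity (\int[mu]_x
  (\sum_(y \in range S) (y * \1_(S @^-1` [set y]) (f x) * H x)%:E))%E.
  apply: eq_integral => x _; rewrite fsumEFin //; congr EFin.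
  by rewrite {1}fimfunE mulr_fsuml.
have mI y : measurable_fun setT (fun x => \1_(S @^-1` [set y]) (f x) : R).
  by apply: measurableT_comp => //; exact: measurable_indic.
rewrite ge0_integral_fsum //; last 2 first.
- move=> y; apply/measurable_EFinP; apply: measurable_funM => //.
  exact: measurable_funM.
- move=> y x _; rewrite EFinM mule_ge0 ?lee_fin//.
  by have := nnfun_muleindic_ge0 S y (f x); rewrite lee_fin.
apply: eq_fsbigr => y; rewrite inE => -[z _ <-].
rewrite -ge0_integralZl //.
- by apply: eq_integral => x _; rewrite -EFinM mulrA.
- by apply/measurable_EFinP; exact: measurable_funM.
- by move=> x _; rewrite lee_fin mulr_ge0.
- by rewrite lee_fin.
Qed.

Lemma cvg_integral_nnsfun_approx_mul (phi : R -> R)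
    (mphi : measurable_fun setT (EFin \o phi)) : (forall z, 0 <= phi z) ->
  (fun n => \int[mu]_x (nnsfun_approx measurableT mphi n (f x) * H x)%:E)%E @ \oo -->
  (\int[mu]_x (phi (f x) * H x)%:E)%E.
Proof.
move=> phi0; set S := nnsfun_approx measurableT mphi.
have lE x : (phi (f x) * H x)%:E = limn (fun n => (S n (f x) * H x)%:E).
  apply/esym/cvg_lim => //; apply: cvg_EFin; first by near=> n.
  apply: cvgM; last exact: cvg_cst.
  have := @cvg_nnsfun_approx _ _ R setT measurableT _ mphi
    (fun z _ => _ : (0 <= (EFin \o phi) z)%E) (f x) I.
  move=> /(_ _)/wrap[z|]; first by rewrite /= lee_fin.
  by move=> /fine_cvg.
under eq_integral do rewrite lE.
apply: cvg_monotone_convergence => //.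
- move=> n; apply/measurable_EFinP; apply: measurable_funM => //.
  exact: measurableT_comp.
- by move=> n x _; rewrite lee_fin mulr_ge0.
- move=> x _ a b ab; rewrite lee_fin ler_wpM2r//.
  exact/lefP/nd_nnsfun_approx.
Unshelve. all: by end_near. Qed.

End OneSide.

(** Simple functions increase to [phi]. There are two uses: with both measures equal to [P] and [K]
    constant it splits off an independent factor; with Lebesgue measure and [K] a density it
    computes an expectation from the law. *)
Lemma ge0_integral_transfer (d d' : measure_display)
    (X : measurableType d) (Y : measurableType d')
    (mu : {measure set X -> \bar R}) (nu : {measure set Y -> \bar R})
    (f H : X -> R) (g K : Y -> R) (phi : R -> R) :
  measurable_fun setT f -> measurable_fun setT H -> (forall x, 0 <= H x) ->
  measurable_fun setT g -> measurable_fun setT K -> (forall x, 0 <= K x) ->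
  (forall A : set R, measurable A ->
    \int[mu]_x (\1_A (f x) * H x)%:E = \int[nu]_y (\1_A (g y) * K y)%:E)%E ->
  measurable_fun setT phi -> (forall z, 0 <= phi z) ->
  (\int[mu]_x (phi (f x) * H x)%:E = \int[nu]_y (phi (g y) * K y)%:E)%E.
Proof.
move=> mf mH H0 mg mK K0 hA mphi phi0.
have mphi' : measurable_fun setT (EFin \o phi) by exact/measurable_EFinP.
have c1 := cvg_integral_nnsfun_approx_mul (mu := mu) mf mH H0 mphi' phi0.
have c2 := cvg_integral_nnsfun_approx_mul (mu := nu) mg mK K0 mphi' phi0.
rewrite -(cvg_lim _ c1) // -(cvg_lim _ c2) //; congr (limn _).
apply/funext => n; rewrite !integral_nnsfun_comp_mul //.
by apply: eq_fsbigr => y _; rewrite hA.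
Qed.

End Transfer.

Section Independence.
Context (d : measure_display) (T : measurableType d) (R : realType).
Context (P : probability T R) (I : finType) (g : I -> {RV P >-> R}).
Hypothesis indep : mutually_independent g.
Implicit Type psi : I -> R -> R.

Let mcomp psi (m : forall b, measurable_fun setT (psi b)) b :
  measurable_fun setT (fun w => psi b (g b w)).
Proof. exact: measurableT_comp. Qed.

Let mprod psi (m : forall b, measurable_fun setT (psi b)) (Q : pred I) :
  measurable_fun setT (fun w => \prod_(b | Q b) psi b (g b w)).
Proof.
under eq_fun do rewrite -big_filter.
by apply: measurable_prod => b _; exact: mcomp.
Qed.

Lemma integral_prod_indic (A : I -> set R) : (forall b, measurable (A b)) ->
  (\int[P]_w (\prod_b (\1_(A b) (g b w) : R))%:E =
   (\prod_b \int[P]_w (\1_(A b) (g b w)))%:E)%E.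
Proof.
move=> mA.
have mgA b : measurable (g b @^-1` A b) by rewrite -[_ @^-1` _]setTI; exact: measurable_funPT.
have E1 b : \int[P]_w (\1_(A b) (g b w)) = fine (P (g b @^-1` A b)).
  rewrite /Rintegral; congr fine.
  by rewrite -[X in _ = P X]setIT -integral_indic.
have -> : (\prod_b \int[P]_w (\1_(A b) (g b w)))%:E = (\prod_b P (g b @^-1` A b))%E.
  rewrite -prodEFin; apply: eq_bigr => b _; rewrite E1 fineK//.
  exact: fin_num_measure.
have := @indep [set: I]%SET A mA.
rewrite (eq_bigl xpredT) => [|b]; last by rewrite finset.in_setT.
rewrite [RHS](eq_bigl xpredT) => [|b]; last by rewrite finset.in_setT.
move=> <-.
rewrite -[X in _ = P X]setIT -integral_indic //; last exact: bigsetI_measurable.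
apply: eq_integral => w _; congr EFin.
apply: (big_ind2 (fun r (S : set T) => r = \1_S w)) => [|r1 S1 r2 S2 -> ->|b _].
- by rewrite indicT.
- by rewrite indicI.
- by rewrite !indicE.
Qed.

(** [K] contains the factors that may fail to be indicators; the transfer replaces them one by one,
    until independence itself applies. *)
Let ge0_case (K : {set I}) psi :
  (forall b, measurable_fun setT (psi b)) -> (forall b x, 0 <= psi b x) ->
  (forall b, b \notin K -> exists2 A : set R, measurable A & psi b = \1_A) ->
  (forall b, P.-integrable setT (EFin \o (fun w => psi b (g b w)))) ->
  (\int[P]_w (\prod_b psi b (g b w))%:E =
   (\prod_b \int[P]_w (psi b (g b w)))%:E)%E.
Proof.
move: {2}#|K| (erefl #|K|) => k; elim: k K psi => [|k IH] K psi.
  move/eqP; rewrite cards_eq0 => /eqP -> m psi0 ind _.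
  have /choice[A hA] : forall b, exists A : set R, measurable A /\ psi b = \1_A.
    by move=> b; have [|A mA ->] := ind b; [rewrite finset.inE|exists A].
  have mA b : measurable (A b) by have [] := hA b.
  have -> : psi = fun b => \1_(A b) by apply/funext => b; have [] := hA b.
  exact: integral_prod_indic.
move=> hK m psi0 ind intb.
have [b0 b0K] : exists b, b \in K by apply/card_gt0P; rewrite hK.
pose H w := \prod_(b | b != b0) psi b (g b w).
pose C := \prod_(b | b != b0) \int[P]_w (psi b (g b w)).
have H0 w : 0 <= H w by apply: prodr_ge0.
have C0 : 0 <= C by apply: prodr_ge0 => b _; apply: Rintegral_ge0.
have mH : measurable_fun setT H by exact: mprod.
transitivity (\int[P]_w (psi b0 (g b0 w) * H w)%:E)%E.
  by apply: eq_integral => w _; rewrite (bigD1 b0).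
rewrite (@ge0_integral_transfer _ _ _ _ _ P P (g b0) H (g b0) (cst C)) //.
- rewrite (bigD1 b0) //= -/C mulrC EFinM.
  rewrite /Rintegral fineK; last exact: (integrable_fin_num measurableT (intb b0)).
  rewrite -integralZl //=; last exact: intb.
  by apply: eq_integral => w _; rewrite -EFinM mulrC.
- move=> A mA.
  pose psi' b := if b == b0 then \1_A else psi b.
  have psi'E b : b != b0 -> psi' b = psi b by rewrite /psi' => /negbTE ->.
  have psi'0 : psi' b0 = \1_A by rewrite /psi' eqxx.
  have iA : P.-integrable setT (EFin \o (fun w => (\1_A (g b0 w) : R))).
    apply: (@le_integrable _ _ _ P setT measurableT _ (EFin \o cst 1)).
    + apply/measurable_EFinP; apply: measurableT_comp => //; exact: measurable_indic.
    + by move=> w _ /=; rewrite lee_fin normr1 ger0_norm // indicE lern1; case: (_ \in _).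
    + exact: finite_measure_integrable_cst.
  have := IH (K :\ b0)%SET psi'.
  move=> /(_ _)/wrap[|]; first by have := cardsD1 b0 K; rewrite b0K hK => -[].
  move=> /(_ _)/wrap[b|].
    by rewrite /psi'; case: eqP => // _; exact: measurable_indic.
  move=> /(_ _)/wrap[b x|].
    by rewrite /psi'; case: eqP => // _; rewrite indicE.
  move=> /(_ _)/wrap[b|].
    rewrite /psi' !finset.inE; case: eqP => [_ _|_ /= /ind //].
    by exists A.
  move=> /(_ _)/wrap[b|].
    have [->|bb0] := eqVneq b b0; first by rewrite psi'0.
    by rewrite psi'E.
  rewrite (bigD1 b0) //= psi'0.
  rewrite (eq_bigr (fun b => \int[P]_w (psi b (g b w)))) => [|b bb0]; last by rewrite psi'E.
  rewrite -/C mulrC EFinM /Rintegral fineK; last exact: (integrable_fin_num measurableT iA).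
  rewrite -integralZl // => e.
  transitivity (\int[P]_w (\prod_b psi' b (g b w))%:E)%E.
    apply: eq_integral => w _; rewrite (bigD1 b0) //= psi'0; congr (_ * _)%:E.
    by apply: eq_bigr => b bb0; rewrite psi'E.
  rewrite e; apply: eq_integral => w _.
  by rewrite -EFinM mulrC.
Qed.

Let integrable_funrpos (f : T -> R) :
  P.-integrable setT (EFin \o f) ->
  P.-integrable setT (EFin \o (fun w => Num.max (f w) 0)) /\
  P.-integrable setT (EFin \o (fun w => Num.max (- f w) 0)).
Proof.
move=> fi; have mf : measurable_fun setT f by apply/measurable_EFinP; case/integrableP: fi.
split; apply: (le_integrable measurableT _ _ fi).
- by apply/measurable_EFinP; apply: measurable_maxr.
- move=> w _ /=; rewrite lee_fin ger0_norm ?le_max ?lexx ?orbT//.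
  by rewrite ge_max ler_norm normr_ge0.
- apply/measurable_EFinP; apply: measurable_maxr => //; exact: measurableT_comp.
- move=> w _ /=; rewrite lee_fin ger0_norm ?le_max ?lexx ?orbT//.
  by rewrite ge_max -normrN ler_norm normr_ge0.
Qed.

(** [J] contains the factors of arbitrary sign; each in turn is split into its positive and negative
    parts. *)
Let signed_case (J : {set I}) psi :
  (forall b, measurable_fun setT (psi b)) ->
  (forall b, b \notin J -> forall x, 0 <= psi b x) ->
  (forall b, P.-integrable setT (EFin \o (fun w => psi b (g b w)))) ->
  P.-integrable setT (EFin \o (fun w => \prod_b psi b (g b w))) /\
  \int[P]_w (\prod_b psi b (g b w)) = \prod_b \int[P]_w (psi b (g b w)).
Proof.
move: {2}#|J| (erefl #|J|) => k; elim: k J psi => [|k IH] J psi.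
  move/eqP; rewrite cards_eq0 => /eqP -> m psi0 intb.
  have {}psi0 b x : 0 <= psi b x by apply: psi0; rewrite finset.inE.
  have e := @ge0_case [set: I]%SET psi m psi0 _ intb.
  move: e => /(_ _)/wrap[b|e]; first by rewrite finset.in_setT.
  split; last by rewrite [LHS]/Rintegral e.
  apply/integrableP; split; first by apply/measurable_EFinP; exact: mprod.
  under eq_integral => w _ do rewrite /= ger0_norm ?prodr_ge0//.
  by rewrite e ltry.
move=> hJ m psi0 intb.
have [b0 b0J] : exists b, b \in J by apply/card_gt0P; rewrite hJ.
pose pp b := if b == b0 then (fun x => Num.max (psi b x) 0) else psi b.
pose pn b := if b == b0 then (fun x => Num.max (- psi b x) 0) else psi b.
have hJ' : #|(J :\ b0)%SET| = k by have := cardsD1 b0 J; rewrite b0J hJ => -[].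
have [ip iN] := integrable_funrpos (intb b0).
have [|||ip1 ep1] := IH _ pp hJ'.
- move=> b; rewrite /pp; case: eqP => // _; exact: measurable_maxr.
- move=> b; rewrite !finset.inE /pp; case: eqP => [_ _ x|_ /= /psi0 //].
  by rewrite le_max lexx orbT.
- by move=> b; rewrite /pp; case: eqP => [->|].
have [|||in1 en1] := IH _ pn hJ'.
- move=> b; rewrite /pn; case: eqP => // _; apply: measurable_maxr => //; exact: measurableT_comp.
- move=> b; rewrite !finset.inE /pn; case: eqP => [_ _ x|_ /= /psi0 //].
  by rewrite le_max lexx orbT.
- by move=> b; rewrite /pn; case: eqP => [->|].
have mE := @maxr_posBneg R.
have E w : \prod_b psi b (g b w) = \prod_b pp b (g b w) - \prod_b pn b (g b w).
  rewrite [X in _ = X - _](bigD1 b0) //= [X in _ = _ - X](bigD1 b0) //= [LHS](bigD1 b0) //=.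
  rewrite [in LHS](mE (psi b0 _)) mulrBl {1}/pp {1}/pn eqxx.
  by congr (_ * _ - _ * _); apply: eq_bigr => b /negbTE hb; rewrite /pp /pn hb.
have -> : (fun w => \prod_b psi b (g b w)) =
   (fun w => \prod_b pp b (g b w) - \prod_b pn b (g b w)) by apply/funext.
split; first exact: (integrableB measurableT ip1 in1).
rewrite RintegralB // ep1 en1.
rewrite [X in X - _ = _](bigD1 b0) //= [X in _ - X = _](bigD1 b0) //= [RHS](bigD1 b0) //=.
rewrite {1}/pp {1}/pn eqxx.
have -> : \int[P]_w (psi b0 (g b0 w)) =
  \int[P]_w (Num.max (psi b0 (g b0 w)) 0) - \int[P]_w (Num.max (- psi b0 (g b0 w)) 0).
  by rewrite -RintegralB //; apply: eq_Rintegral => w _; exact: mE.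
rewrite mulrBl.
by congr (_ * _ - _ * _); apply: eq_bigr => b /negbTE hb; rewrite /pp /pn hb.
Qed.

Lemma independent_integral_prod psi :
  (forall b, measurable_fun setT (psi b)) ->
  (forall b, P.-integrable setT (EFin \o (fun w => psi b (g b w)))) ->
  P.-integrable setT (EFin \o (fun w => \prod_b psi b (g b w))) /\
  \int[P]_w (\prod_b psi b (g b w)) = \prod_b \int[P]_w (psi b (g b w)).
Proof.
move=> m i; apply: (@signed_case [set: I]%SET) => // b.
by rewrite finset.inE.
Qed.

End Independence.

(** * Moments of the standard normal law *)

Section GaussianMoments.
Variable R : realType.
Local Notation mu := (@lebesgue_measure R).
Local Notation phi := (@normal_pdf R 0 1).

Lemma std_normal_pdfE (x : R) : phi x = normal_peak 1 * expR (- x ^+ 2 / 2).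
Proof.
by rewrite normal_pdfE ?oner_eq0// /normal_fun subr0 expr1n.
Qed.

Lemma exprn_le_expR (k : nat) : exists2 C : R, 0 <= C &
  forall x : R, `|x| ^+ k <= C * expR (x ^+ 2 / 4).
Proof.
(* The term of degree k + 1 of the exponential series at y = x^2 / 4 bounds x^(2(k+1)); the 1 covers
   |x| <= 1. *)
exists (1 + 4 ^+ k.+1 * (k.+1)`!%:R).
  by rewrite addr_ge0// mulr_ge0// exprn_ge0.
move=> x; set y := x ^+ 2 / 4.
have y0 : 0 <= y by rewrite divr_ge0// sqr_ge0.
have f0 : 0 < (k.+1)`!%:R :> R by rewrite ltr0n fact_gt0.
have e1 : 1 <= expR y by rewrite -expR0 ler_expR.
have e2 : y ^+ k.+1 <= (k.+1)`!%:R * expR y.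
  by rewrite mulrC -ler_pdivrMr //; have := expR_ge1Dxn k y0; lra.
have e3 : `|x| ^+ k <= 1 + (x ^+ 2) ^+ k.+1.
  rewrite -exprM -[x ^+ _]ger0_norm ?exprn_even_ge0 ?oddM// normrX.
  have [h|h] := leP `|x| 1.
    by rewrite ler_wpDr ?exprn_ge0// exprn_ile1.
  by rewrite ler_wpDl// ler_weXn2l ?(ltW h)//; lia.
apply: (le_trans e3).
have -> : (x ^+ 2) ^+ k.+1 = 4 ^+ k.+1 * y ^+ k.+1.
  by rewrite -exprMn /y mulrC divfK.
have : 4 ^+ k.+1 * y ^+ k.+1 <= 4 ^+ k.+1 * ((k.+1)`!%:R * expR y).
  by rewrite ler_wpM2l// exprn_ge0.
rewrite mulrDl mul1r mulrA; lra.
Qed.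

Let peak_ge0 s := @normal_peak_ge0 R s.

Let c_phi : continuous phi.
Proof. by apply: continuous_normal_pdf; rewrite oner_eq0. Qed.

Let c_term k : continuous (fun x : R => x ^+ k * phi x).
Proof. by move=> x; apply: cvgM; [exact: exprn_continuous|exact: c_phi]. Qed.

Let m_term k : measurable_fun setT (fun x : R => x ^+ k * phi x).
Proof. by apply: continuous_measurable_fun; exact: c_term. Qed.

Lemma integrable_gauss_moment k :
  mu.-integrable setT (EFin \o (fun x : R => x ^+ k * phi x)).
Proof.
have [C C0 hC] := exprn_le_expR k.
have s0 : Num.sqrt 2 != 0 :> R by rewrite sqrtr_eq0 -ltNge.
(* The dominating function is a multiple of the normal density of variance 2: half of the exponent
   absorbs the power. *)
pose q := normal_pdf 0 (Num.sqrt 2 : R).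
have qE x : q x = normal_peak (Num.sqrt 2) * expR (- x ^+ 2 / 4).
  rewrite /q normal_pdfE // /normal_fun subr0 sqr_sqrtr//.
  by congr (_ * expR (_ / _)); rewrite -mulr_natr; ring.
have pk := normal_peak_gt0 s0.
pose D := C * normal_peak 1 / normal_peak (Num.sqrt 2 : R).
have iq : mu.-integrable setT (EFin \o (fun x => D * q x)).
  exact: (integrableZl measurableT D (integrable_normal_pdf 0 (Num.sqrt 2))).
apply: (le_integrable measurableT _ _ iq).
  by apply/measurable_EFinP; exact: m_term.
move=> x _ /=; rewrite lee_fin.
apply: le_trans (ler_norm _).
rewrite normrM [X in _ * X]ger0_norm ?normal_pdf_ge0// normrX qE std_normal_pdfE.
have -> : D * (normal_peak (Num.sqrt 2) * expR (- x ^+ 2 / 4)) =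
   C * expR (x ^+ 2 / 4) * (normal_peak 1 * expR (- x ^+ 2 / 2)).
  have -> : - x ^+ 2 / 4 = x ^+ 2 / 4 + (- x ^+ 2 / 2) by lra.
  by rewrite expRD /D; field; rewrite gt_eqF.
by rewrite ler_wpM2r// mulr_ge0// expR_ge0.
Qed.

(** [exprn_le_expR] for exponent k + 1 bounds |x| times each boundary term, so these are O(1/n). *)
Lemma cvg_gauss_boundary k :
  (fun n : nat => (n%:R : R) ^+ k * phi n%:R - (- n%:R) ^+ k * phi (- n%:R)) @ \oo --> (0 : R).
Proof.
have [C C0 hC] := exprn_le_expR k.+1.
have b (x : R) : `|x| * `|x ^+ k * phi x| <= C * normal_peak 1.
  rewrite normrM [X in _ * (_ * X)]ger0_norm ?normal_pdf_ge0// normrX mulrA -exprS.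
  rewrite std_normal_pdfE mulrCA [leRHS]mulrC ler_wpM2l//.
  apply: le_trans (_ : C * expR (x ^+ 2 / 4) * expR (- x ^+ 2 / 2) <= _).
    by rewrite ler_wpM2r// expR_ge0.
  rewrite -mulrA -expRD ler_piMr// -[leRHS]expR0 ler_expR.
  have := sqr_ge0 x; lra.
pose K := 2 * (C * normal_peak 1).
have K0 : (fun n : nat => K * (n.+1%:R)^-1) @ \oo --> (0 : R).
  rewrite -[X in _ --> X](mulr0 K); apply: cvgM; first exact: cvg_cst.
  exact: cvg_harmonic.
rewrite -(cvg_shiftS (fun n : nat => (n%:R : R) ^+ k * phi n%:R - (- n%:R) ^+ k * phi (- n%:R))).
apply: norm_cvg0.
apply: (@squeeze_cvgr _ _ _ _ (cst 0) (fun n : nat => K * (n.+1%:R)^-1)) => //; last exact: cvg_cst.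
near=> n; rewrite normr_ge0 /= ler_pdivlMr ?ltr0n//.
apply: le_trans (_ : (`|n.+1%:R ^+ k * phi n.+1%:R| + `|(- n.+1%:R) ^+ k * phi (- n.+1%:R)|) * n.+1%:R <= _).
  by rewrite ler_wpM2r// ler_normB.
have := b n.+1%:R; have := b (- n.+1%:R); rewrite normrN ger0_norm// /K; lra.
Unshelve. all: by end_near. Qed.

Definition gauss_moment (k : nat) : R := \int[mu]_x (x ^+ k * phi x).

Lemma is_derive_gauss k (x : R) :
  is_derive x 1 (fun x : R => x ^+ k * phi x)
    (k%:R * (x ^+ k.-1 * phi x) - x ^+ k.+1 * phi x).
Proof.
have dphi : is_derive x 1 phi (- x * phi x).
  have -> : phi = (fun y => normal_peak 1 * expR (- 2^-1 * y ^+ 2)).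
    apply/funext => y; rewrite std_normal_pdfE; congr (_ * expR _); lra.
  have d2 : is_derive x 1 (fun y : R => - 2^-1 * y ^+ 2) (- x).
    apply: (is_derive_eq (is_derive_mull (- 2^-1) (is_derive_exprn 2 (is_derive_id x 1)))).
    rewrite /= expr1; lra.
  have d3 := @is_derive1_comp _ expR (fun y : R => - 2^-1 * y ^+ 2) x _ _ (is_derive_expR _) d2.
  apply: (is_derive_eq (is_derive_mull (normal_peak 1) d3)).
  by rewrite /GRing.scale/=; ring.
apply: (is_derive_eq (is_derive_mulr (is_derive_exprn k (is_derive_id x 1)) dphi)).
by rewrite exprS; ring.
Qed.

(** The derivative of x^k phi(x) is integrated over [-n, n], and dominated convergence lets n tend
    to infinity. This is Stein's identity for monomials; at k = 0 it says that the mean is 0. *)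
Lemma gauss_moment_rec k : gauss_moment k.+1 = k%:R * gauss_moment k.-1.
Proof.
pose f (x : R) := k%:R * (x ^+ k.-1 * phi x) - x ^+ k.+1 * phi x.
have i1 : mu.-integrable setT (EFin \o (fun x : R => k%:R * (x ^+ k.-1 * phi x))).
  exact: (integrableZl measurableT k%:R (integrable_gauss_moment k.-1)).
have fi : mu.-integrable setT (EFin \o f).
  exact: (integrableB measurableT i1 (integrable_gauss_moment k.+1)).
have cf : continuous f.
  move=> x; apply: cvgB; last exact: c_term.
  by apply: cvgM; [exact: cvg_cst|exact: c_term].
have mf : measurable_fun setT f by exact: continuous_measurable_fun.
suff f0 : \int[mu]_x f x = 0.
  move: f0; rewrite RintegralB //; last exact: integrable_gauss_moment.
  rewrite RintegralZl //; last exact: integrable_gauss_moment.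
  by move/eqP; rewrite subr_eq0 => /eqP.
have mfn n : measurable_fun setT (f \_ `[- (n%:R : R), n%:R]).
  by apply/(measurable_restrictT _ _).1 => //; exact: measurable_funTS.
have [|||||_ _] := @dominated_convergence _ _ _ mu setT measurableT
  (fun n : nat => EFin \o (f \_ `[- (n%:R : R), n%:R])) (EFin \o f) (abse \o (EFin \o f)).
- by move=> n; apply/measurable_EFinP; exact: mfn.
- by apply/measurable_EFinP; exact: mf.
- apply: aeW => x _; apply: cvg_near_cst.
  near=> n; rewrite /= patchE mem_set //= in_itv /= -ler_norml.
  by near: n; exact: nbhs_infty_ger.
- exact: integrable_abse.
- apply: aeW => x n _ /=; rewrite patchE lee_fin; case: ifP => // _.
  by rewrite normr0.
rewrite /= => cv.
suff cv0 : (fun n : nat => \int[mu]_x (f \_ `[- (n%:R : R), n%:R]) x)%R @ \oo --> (0 : R).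
  rewrite /Rintegral -(cvg_lim _ cv) //.
  have -> : (fun n : nat => \int[mu]_x ((f \_ `[- (n%:R : R), n%:R]) x)%:E)%E
    = EFin \o (fun n : nat => \int[mu]_x (f \_ `[- (n%:R : R), n%:R]) x)%R.
    apply/funext => n /=; rewrite fineK //; apply: integrable_fin_num => //.
    apply: (le_integrable measurableT _ _ fi); first by apply/measurable_EFinP; exact: mfn.
    by move=> x _ /=; rewrite patchE lee_fin; case: ifP => // _; rewrite normr0.
  have /cvg_lim -> // :
    (EFin \o (fun n : nat => \int[mu]_x (f \_ `[- (n%:R : R), n%:R]) x)%R) @ \oo
    --> (0 : R)%:E.
  by apply: cvg_EFin => //; near=> n.
rewrite -(cvg_shiftS (fun n : nat => \int[mu]_x (f \_ `[- (n%:R : R), n%:R]) x)%R).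
have := @cvg_gauss_boundary k.
rewrite -(cvg_shiftS (fun n : nat => (n%:R : R) ^+ k * phi n%:R - (- n%:R) ^+ k * phi (- n%:R))).
apply: cvg_trans; apply: near_eq_cvg; near=> n.
have ab : - (n.+1%:R) < n.+1%:R :> R by rewrite -subr_gt0 opprK -natrD ltr0n.
by rewrite /= -Rintegral_mkcond (Rintegral_FTC2 ab (is_derive_gauss k) cf).
Unshelve. all: by end_near. Qed.

Section Law.
Context (d : measure_display) (T : measurableType d) (P : probability T R).
Variable X : {RV P >-> R}.
Hypothesis nX : standard_normal X.

Let ge0_integral_std_normal (psi : R -> R) : measurable_fun setT psi ->
  (forall x, 0 <= psi x) ->
  (\int[P]_w (psi (X w))%:E = \int[mu]_x (psi x * phi x)%:E)%E.
Proof.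
move=> mpsi psi0.
transitivity (\int[P]_w (psi (X w) * cst 1 w)%:E)%E.
  by apply: eq_integral => w _; rewrite /= mulr1.
rewrite (@ge0_integral_transfer _ _ _ _ _ P mu X (cst 1) id phi) //.
- exact: measurable_normal_pdf.
- by move=> x; exact: normal_pdf_ge0.
move=> A mA.
have e : distribution P X A = (\int[mu]_x ((EFin \o phi) \_ A) x)%E.
  by rewrite (nX mA) /normal_prob integral_mkcond.
transitivity (distribution P X A).
  rewrite /distribution /pushforward /= -[X in _ = P X]setIT -integral_indic //.
    by apply: eq_integral => w _; rewrite /= mulr1.
  by rewrite -[_ @^-1` _]setTI; exact: measurable_funPT.
rewrite e; apply: eq_integral => x _; rewrite patchE indicE.
by case: ifP => _; rewrite ?mul1r ?mul0r.
Qed.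

(** The transfer covers nonnegative functions; a general power is reached through its positive and
    negative parts, both dominated by its absolute value. *)
Lemma std_normal_moment k :
  P.-integrable setT (EFin \o (fun w => X w ^+ k)) /\
  \int[P]_w (X w ^+ k) = gauss_moment k.
Proof.
have mX : measurable_fun setT X by [].
have mXk : measurable_fun setT (fun x : R => x ^+ k) by exact: measurable_funX.
have iX : P.-integrable setT (EFin \o (fun w => X w ^+ k)).
  apply/integrableP; split.
    by apply/measurable_EFinP; exact: measurable_funX.
  have := @ge0_integral_std_normal (fun x => `|x ^+ k|) _ _.
  move=> /(_ _ _)/wrap[||e]; [exact: measurableT_comp|by []|].
  rewrite [ltLHS]e; have /integrableP[_] := integrable_gauss_moment k.
  by under eq_integral do rewrite /= normrM [X in _ * X]ger0_norm ?normal_pdf_ge0//.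
split=> //.
have mE := @maxr_posBneg R.
have part (psi : R -> R) : measurable_fun setT psi -> (forall x, 0 <= psi x) ->
    (forall x, psi x <= `|x ^+ k|) ->
    [/\ P.-integrable setT (EFin \o (fun w => psi (X w))),
        mu.-integrable setT (EFin \o (fun x => psi x * phi x)) &
        \int[P]_w (psi (X w)) = \int[mu]_x (psi x * phi x)].
  move=> m psi0 psib; split.
  - apply: (le_integrable measurableT _ _ iX).
      by apply/measurable_EFinP; exact: measurableT_comp.
    by move=> w _ /=; rewrite lee_fin ger0_norm.
  - apply: (le_integrable measurableT _ _ (integrable_gauss_moment k)).
      apply/measurable_EFinP; apply: measurable_funM => //; exact: measurable_normal_pdf.
    move=> x _ /=; rewrite lee_fin !normrM ler_wpM2r// ger0_norm//.
  - by rewrite /Rintegral ge0_integral_std_normal.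
have [||| p1 p2 p3] := part (fun x => Num.max (x ^+ k) 0).
- exact: measurable_maxr.
- by move=> x; rewrite le_max lexx orbT.
- by move=> x; rewrite ge_max ler_norm normr_ge0.
have [||| n1 n2 n3] := part (fun x => Num.max (- (x ^+ k)) 0).
- by apply: measurable_maxr => //; exact: measurableT_comp.
- by move=> x; rewrite le_max lexx orbT.
- by move=> x; rewrite ge_max -normrN ler_norm normr_ge0.
transitivity (\int[P]_w (Num.max (X w ^+ k) 0 - Num.max (- (X w ^+ k)) 0)).
  by apply: eq_Rintegral => w _; exact: mE.
rewrite RintegralB // p3 n3 -RintegralB //; apply: eq_Rintegral => x _.
by rewrite -mulrBl -mE.
Qed.

End Law.
End GaussianMoments.

(** * Independent standard normal variables as a Gaussian functional *)

Section GaussianVector.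
Variables (R : realType) (I : finType).
Context (d : measure_display) (T : measurableType d) (P : probability T R).
Variable g : I -> {RV P >-> R}.
Hypotheses (indep : mutually_independent g) (normal_g : forall b, standard_normal (g b)).

Definition expect_fun (f : (I -> R) -> R) : R := \int[P]_w f (fun b => g b w).

Let ev (f : (I -> R) -> R) (w : T) : R := f (fun b => g b w).

Let monom_moment m :
  P.-integrable setT (EFin \o ev (monom m)) /\
  expect_fun (monom m) = \prod_b gauss_moment R (m b).
Proof.
have [||h1 h2] := @independent_integral_prod _ _ _ _ _ g indep (fun b x => x ^+ m b).
- by move=> b; exact: measurable_funX.
- by move=> b; exact: (std_normal_moment (normal_g b) (m b)).1.
split => //; rewrite /expect_fun /monom h2; apply: eq_bigr => b _.
exact: (std_normal_moment (normal_g b) (m b)).2.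
Qed.

Let lin_expect (s : seq (R * {ffun I -> nat})) :
  P.-integrable setT (EFin \o ev (fun x => \sum_(p <- s) p.1 * monom p.2 x)) /\
  expect_fun (fun x => \sum_(p <- s) p.1 * monom p.2 x) =
  \sum_(p <- s) p.1 * expect_fun (monom p.2).
Proof.
elim: s => [|p s [IH1 IH2]].
  have -> : (fun x : I -> R => \sum_(p <- [::]) p.1 * monom p.2 x) = (fun=> 0).
    by apply/funext => x; rewrite big_nil.
  rewrite big_nil; split; first exact: finite_measure_integrable_cst.
  by rewrite /expect_fun Rintegral_cst // mul0r.
have -> : (fun x : I -> R => \sum_(q <- p :: s) q.1 * monom q.2 x) =
   (fun x => p.1 * monom p.2 x + \sum_(q <- s) q.1 * monom q.2 x).
  by apply/funext => x; rewrite big_cons.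
have [i1 _] := monom_moment p.2.
have i2 : P.-integrable setT (EFin \o (fun w => p.1 * ev (monom p.2) w)).
  exact: (integrableZl measurableT p.1 i1).
split; first exact: (integrableD measurableT i2 IH1).
by rewrite big_cons -IH2 /expect_fun RintegralD // RintegralZl.
Qed.

Lemma integrable_polyfun f : polyfun f -> P.-integrable setT (EFin \o (fun w => f (fun b => g b w))).
Proof.
move=> [f' [s [h _]]]; have [i _] := lin_expect s.
by have -> : f = (fun x => \sum_(p <- s) p.1 * monom p.2 x) by apply/funext.
Qed.

(** By linearity Stein's identity reduces to monomials, whose expectation factorises; only the
    factor of the variable [a] changes, by [gauss_moment_rec]. *)
Lemma gaussian_functional_expect : gaussian_functional expect_fun.
Proof.
split.
- by move=> f1 f2 e; congr expect_fun; apply/funext.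
- rewrite /expect_fun Rintegral_cst // mul1r.
  by have /(congr1 fine) := @probability_setT _ _ _ P.
- move=> f1 f2 /integrable_polyfun i1 /integrable_polyfun i2.
  by rewrite /expect_fun RintegralD.
- move=> c f /integrable_polyfun i1.
  by rewrite /expect_fun RintegralZl.
move=> f f' a [s [h h']].
have -> : (fun x => x a * f x) =
    (fun x => \sum_(p <- [seq (q.1, expo_succ a q.2) | q : R * {ffun I -> nat} <- s]) p.1 * monom p.2 x).
  apply/funext => x; rewrite h big_map mulr_sumr; apply: eq_bigr => p _ /=.
  by rewrite monom_succ; ring.
have -> : f' a = (fun x => \sum_(p <- [seq (q.1 * (q.2 a)%:R, expo_pred a q.2)
    | q : R * {ffun I -> nat} <- s]) p.1 * monom p.2 x).
  by apply/funext => x; rewrite h' big_map; apply: eq_bigr => p _; rewrite dmonomE mulrA.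
rewrite !(lin_expect _).2 !big_map; apply: eq_bigr => -[c m] _ /=.
rewrite !(monom_moment _).2 -mulrA; congr (_ * _).
rewrite (bigD1 a) //= [X in _ = _ * X](bigD1 a) //= !ffunE eqxx gauss_moment_rec -mulrA.
congr (_ * (_ * _)); apply: eq_bigr => b /negbTE hb; by rewrite !ffunE hb.
Qed.

End GaussianVector.

(** * Large N limits *)

Section Limits.
Variable R : realType.

Lemma cvg_natr_inv : (fun N : nat => (N%:R : R)^-1) @ \oo --> (0 : R).
Proof.
rewrite -(cvg_shiftS (fun N : nat => (N%:R : R)^-1)).
exact: (@cvg_harmonic R).
Qed.

Lemma cvg_natr_invX k : (fun N : nat => (N%:R : R)^-1 ^+ k) @ \oo --> (0 ^+ k : R).
Proof.
apply: (cvg_comp (fun N : nat => (N%:R : R)^-1) (fun x : R => x ^+ k) cvg_natr_inv).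
exact: exprn_continuous.
Qed.

Lemma cvg_sumr (J : Type) (s : seq J) (Q : pred J) (F : J -> nat -> R) (l : J -> R) :
  (forall j, Q j -> F j @ \oo --> l j) ->
  (fun N => \sum_(j <- s | Q j) F j N) @ \oo --> \sum_(j <- s | Q j) l j.
Proof.
move=> h; elim: s => [|j s IH].
  by rewrite big_nil; under eq_cvg do rewrite big_nil; exact: cvg_cst.
rewrite big_cons; under eq_cvg do rewrite big_cons.
by case Qj : (Q j) => //; apply: cvgD => //; exact: h.
Qed.

Lemma cvg_power_ratio (V p : nat) : (V <= p)%N ->
  (fun N : nat => (N%:R : R) ^+ V * N%:R^-1 ^+ p) @ \oo --> ((V == p)%:R : R).
Proof.
move=> Vp.
have e : \forall N \near \oo, ((N%:R : R)^-1) ^+ (p - V) = (N%:R : R) ^+ V * N%:R^-1 ^+ p.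
  near=> N; have N0 : (N%:R : R) != 0 by rewrite pnatr_eq0 -lt0n; near: N; exists 1%N.
  rewrite -{2}(subnK Vp) exprD mulrC -mulrA -exprMn mulVf // expr1n mulr1 //.
(* The convention 0^0 = 1 makes the limit 1 exactly when V = p. *)
have -> : ((V == p)%:R : R) = 0 ^+ (p - V).
  by rewrite expr0n subn_eq0 eqn_leq Vp.
apply: cvg_trans (near_eq_cvg e) _.
exact: cvg_natr_invX.
Unshelve. all: by end_near. Qed.

Variable E : forall N : nat, (('I_N * 'I_N -> R) -> R) -> R.
Hypothesis gE : forall N, gaussian_functional (@E N).

Local Notation m := (semicircle_moment R).

Lemma semicircle_moment_conv k : m k.+1 = \sum_(i < k) m i * m (k - i.+1)%N.
Proof.
case: k => [|k]; first by rewrite big_ord0 semicircle_moment1.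
rewrite (catalan_convolution (semicircle_moment0 R) (semicircle_moment1 R) (@semicircle_moment_rec R)).
by apply: eq_bigr => i _; rewrite subSS.
Qed.

(** The outer induction is on the total degree, the inner one on the list: a power 0 has normalized
    trace 1 and is dropped at equal degree, while a first power k + 1 is treated by the
    Schwinger-Dyson equation. *)
Lemma cvg_expect_tprod ks :
  (fun N => @E N (tprod ks)) @ \oo --> \prod_(k <- ks) m k.
Proof.
move: {2}(sumn ks).+1 (ltnSn (sumn ks)) => n; elim: n ks => // n IHn ks.
rewrite ltnS; elim: ks => [|[|k] ks IHks] hn.
- rewrite big_nil; apply: (@cvg_trans _ ((fun=> 1 : R) @ \oo)); last exact: cvg_cst.
  apply: near_eq_cvg; near=> N; rewrite -[LHS](expect_one (gE N)); apply: (expect_ext (gE N)) => x.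
  by rewrite /tprod big_nil.
- rewrite big_cons semicircle_moment0 mul1r.
  apply: cvg_trans (IHks hn); apply: near_eq_cvg; near=> N.
  have N0 : (N%:R : R) != 0 by rewrite pnatr_eq0 -lt0n; near: N; exists 1%N.
  apply: (expect_ext (gE N)) => x.
  by rewrite /tprod big_cons /mtr expr0 mxtrace1 mulVf // mul1r.
have hn' : (k.+1 + sumn ks <= n)%N by [].
(* The conditional carries membership in [cross k ks], the source of the degree bound; [eq_big_seq]
   removes it at the end. *)
have lim : (fun N => \sum_(i < k) @E N (tprod [:: nat_of_ord i, (k - i.+1)%N & ks]) +
  k%:R * N%:R^-1 * @E N (tprod (k.-1 :: ks)) +
  N%:R^-1 ^+ 2 * \sum_(p <- cross k ks) (if p \in cross k ks then p.1%:R * @E N (tprod p.2) else 0)) @ \oo -->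
  \sum_(i < k) \prod_(l <- [:: nat_of_ord i, (k - i.+1)%N & ks]) m l +
  k%:R * 0 * \prod_(l <- k.-1 :: ks) m l +
  0 ^+ 2 * \sum_(p <- cross k ks) (if p \in cross k ks then p.1%:R * \prod_(l <- p.2) m l else 0).
  apply: cvgD; [apply: cvgD|].
  - apply: cvg_sumr => i _; apply: IHn; rewrite /=.
    by have := ltn_ord i; lia.
  - have [->|k0] := posnP k.
      by rewrite !mul0r; under eq_cvg do rewrite !mul0r; exact: cvg_cst.
    apply: cvgM; first by apply: cvgM; [exact: cvg_cst|exact: cvg_natr_inv].
    by apply: IHn; rewrite /=; lia.
  - apply: cvgM; first exact: cvg_natr_invX.
    apply: cvg_sumr => p _; case: ifP => [hp|_]; last exact: cvg_cst.
    apply: cvgM; first exact: cvg_cst.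
    apply: IHn; apply: leq_trans (cross_degree hp) hn'.
have -> : \prod_(l <- k.+1 :: ks) m l =
  \sum_(i < k) \prod_(l <- [:: nat_of_ord i, (k - i.+1)%N & ks]) m l +
  k%:R * 0 * \prod_(l <- k.-1 :: ks) m l +
  0 ^+ 2 * \sum_(p <- cross k ks) (if p \in cross k ks then p.1%:R * \prod_(l <- p.2) m l else 0).
  rewrite expr0n mul0r mulr0 mul0r !addr0 big_cons semicircle_moment_conv mulr_suml.
  by apply: eq_bigr => i _; rewrite !big_cons mulrA.
apply: cvg_trans lim; apply: near_eq_cvg; near=> N.
rewrite (schwinger_dyson (gE N)); last by near: N; exists 1%N.
by congr (_ + _ * _); apply: eq_big_seq => p ->.
Unshelve. all: by end_near. Qed.

Lemma cvg_infinitesimal_moment n :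
  (fun N => N%:R * (@E N (mtr n.+1) - m n.+1)) @ \oo -->
  (if odd n.+1 then 0 else #|NC2delta n.+1|%:R : R).
Proof.
pose h := (n.+1)./2.
pose V (rho : {perm pm n.+1}) := (vertex_cycles rho)./2.
have eE N : @E N (mtr n.+1) = \sum_(rho in gluing n.+1) N%:R ^+ V rho * N%:R^-1 ^+ h.+1.
  rewrite [LHS](expect_trace_pow (gE N) n) -exprS -/h mulr_sumr.
  by apply: eq_bigr => rho _; rewrite mulrC.
have Vle rho : rho \in gluing n.+1 -> (V rho <= h.+1)%N.
  by move=> /vertex_cycles_le; rewrite addn1.
(* One sequence with two limits: the semicircle moment, and the number of gluings with V = h + 1. *)
have mE : m n.+1 = \sum_(rho in gluing n.+1) (V rho == h.+1)%:R.
  have c1 : (fun N => @E N (mtr n.+1)) @ \oo --> m n.+1.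
    have := @cvg_expect_tprod [:: n.+1]; rewrite big_seq1; apply: cvg_trans.
    apply: near_eq_cvg; near=> N; apply: (expect_ext (gE N)) => x.
    by rewrite /tprod big_seq1.
  have c2 : (fun N => @E N (mtr n.+1)) @ \oo --> \sum_(rho in gluing n.+1) ((V rho == h.+1)%:R : R).
    under eq_cvg do rewrite eE.
    by apply: cvg_sumr => rho hr; apply: cvg_power_ratio; exact: Vle.
  exact: (cvg_unique _ c1 c2).
(* After the subtraction of [mE] and multiplication by N, a gluing with V = h + 1 contributes
   exactly 0 and any other N^(V - h), whose limit tests V = h. *)
have c3 : (fun N => \sum_(rho in gluing n.+1)
    (if V rho == h.+1 then 0 else (N%:R : R) ^+ V rho * N%:R^-1 ^+ h)) @ \oo -->
    \sum_(rho in gluing n.+1) ((V rho == h)%:R : R).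
  apply: cvg_sumr => rho hr; case: eqP => [->|/eqP ne].
    by rewrite eqn_leq ltnn; exact: cvg_cst.
  by apply: cvg_power_ratio; have := Vle rho hr; rewrite leq_eqVlt (negbTE ne).
have -> : (if odd n.+1 then 0 else #|NC2delta n.+1|%:R : R) =
    \sum_(rho in gluing n.+1) ((V rho == h)%:R : R).
  (* A polygon with an odd number of edges has no gluing, so the sum is empty in that case. *)
  case: ifP => [on|/negbT ev].
    by rewrite big1 // => rho /gluing_even; rewrite on.
  rewrite NC2deltaE // -sum1_card natr_sum big_mkcond [RHS]big_mkcond.
  by apply: eq_bigr => rho _; rewrite finset.inE; case: (_ \in _); case: (_ == _).
apply: cvg_trans c3; apply: near_eq_cvg; near=> N.
have N0 : (N%:R : R) != 0 by rewrite pnatr_eq0 -lt0n; near: N; exists 1%N.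
rewrite eE mE -sumrB mulr_sumr; apply: eq_bigr => rho _.
case: eqP => [->|_]; first by rewrite -exprMn mulfV // expr1n subrr mulr0.
by rewrite subr0 exprS [N%:R * (_ * _)]mulrCA mulVKf.
Unshelve. all: by end_near. Qed.

End Limits.

(** * Infinitesimal moments of the GOE *)

Theorem theorem17 (R : realType) (d : nat -> measure_display)
  (T : forall N : nat, measurableType (d N))
  (P : forall N : nat, probability (T N) R)
  (g : forall N : nat, 'I_N * 'I_N -> {RV (P N) >-> R})
  (hg : forall N : nat, iid_standard_normal (g N))
  (n : nat) (hn : (1 <= n)%N) :
  (fun N : nat =>
     (N%:R%:E * ('E_(P N)[fun w => ntr (goe (g N) w ^+ n)]
                 - (semicircle_moment R n)%:E))%E) @ \oo
  --> (if odd n then 0 else #|NC2delta n|%:R : R)%:E.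
Proof.
case: n hn => // n _.
pose E N := @expect_fun R ('I_N * 'I_N)%type (d N) (T N) (P N) (g N).
have gE N : gaussian_functional (E N).
  by have [h1 h2] := hg N; exact: gaussian_functional_expect.
(* The expectation is an extended real; integrability of a polynomial in the entries makes it
   finite, so the limit can be taken in [R]. *)
have EE N : 'E_(P N)[fun w => ntr (goe (g N) w ^+ n.+1)]%E = (E N (mtr n.+1))%:E.
  have [h1 h2] := hg N.
  rewrite unlock /E /expect_fun /Rintegral fineK //.
  apply: integrable_fin_num => //.
  apply: (integrable_polyfun h1 h2); eexists; exact: has_grad_mtr.
have c := @cvg_infinitesimal_moment R E gE n.
have {}c : (EFin \o (fun N : nat => N%:R * (E N (mtr n.+1) - semicircle_moment R n.+1))) @ \oo -->
    (if odd n.+1 then 0 else #|NC2delta n.+1|%:R : R)%:E.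
  by apply: cvg_EFin => //; near=> N.
apply: cvg_trans c; apply: near_eq_cvg; near=> N.
by rewrite /= EE -EFinB -EFinM.
Unshelve. all: by end_near. Qed.
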